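(* Let $\alpha\in[0,1)$ and let $f=h+\overline{g}\in\check{L}_H^{\alpha}$. Then for all $z\in\Delta$, $$|g'(z)| \geq \begin{cases}\displaystyle\frac{(\alpha-|z|)(1-|z|)}{(1-\alpha |z|)(1+|z|)^3},& |z|<\alpha,\\[8pt] 0, & |z|\geq\alpha,\end{cases}$$ and $$|g'(z)| \leq \frac{(\alpha+|z|)(1+|z|)}{(1+\alpha |z|)(1-|z|)^3}.$$
   Context: $\Delta$ is the open unit disc in $\mathbb{C}$. Every complex-valued harmonic function $f$ in $\Delta$ is uniquely represented as $f=h+\overline{g}$ with $h,g$ analytic in $\Delta$ and $g(0)=0$; write $h(z)=\sum_{n=0}^\infty a_nz^n$, $g(z)=\sum_{n=1}^\infty b_nz^n$. The Jacobian of $f$ is $J_f(z)=|h'(z)|^2-|g'(z)|^2$; $f$ is locally one-to-one and sense-preserving in $\Delta$ if and only if $J_f(z)>0$ for all $z\in\Delta$. $L_H$ denotes the set of all locally one-to-one and sense-preserving harmonic functions $f=h+\overline{g}$ in $\Delta$ with $h(0)=0$, $h'(0)=1$ (and $g(0)=0$). A starlike analytic function is a one-to-one analytic function in $\Delta$ fixing $0$ whose image is starlike with respect to the origin. For $\alpha\in[0,1)$, $\check{L}_H^{\alpha}$ is the class of all $f=h+\overline{g}\in L_H$ such that $|b_1|=|g'(0)|=\alpha$ and $h$ is a starlike analytic function. *)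

(* Defs.v *)
From Stdlib Require Import Reals.
From Coquelicot Require Import Coquelicot.

Open Scope R_scope.

(* All functions below are total on [C]; only their values on the open unit
   disc are constrained. *)
Definition unit_disc (z : C) : Prop := Cmod z < 1.

Definition analytic_at (f : C -> C) (c : C) : Prop :=
  exists (a : nat -> C) (r : R), 0 < r /\
    forall z : C, Cmod (z - c)%C < r ->
      @is_pseries C_AbsRing C_NormedModule a (z - c)%C (f z).

Definition analytic_on_disc (f : C -> C) : Prop :=
  forall c : C, unit_disc c -> analytic_at f c.

(* [ex_diff_n u 2] says that [u] is twice differentiable with continuous partial
   derivatives; [partial_derive i j] differentiates i times in the first
   variable and j times in the second. *)
Definition harmonic_at (u : R -> R -> R) (x y : R) : Prop :=
  ex_diff_n u 2 x y /\
  partial_derive 2 0 u x y + partial_derive 0 2 u x y = 0.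

Definition harmonic_on_disc (f : C -> C) : Prop :=
  forall x y : R, unit_disc (x, y) ->
    harmonic_at (fun s t => Re (f (s, t))) x y /\
    harmonic_at (fun s t => Im (f (s, t))) x y.

(* The canonical representation f = h + conj g of a harmonic function. *)
Definition canonical_rep (f h g : C -> C) : Prop :=
  analytic_on_disc h /\ analytic_on_disc g /\ g 0%C = 0%C /\
  forall z : C, unit_disc z -> f z = (h z + Cconj (g z))%C.

Definition locally_injective_on_disc (f : C -> C) : Prop :=
  forall z : C, unit_disc z -> exists r : R, 0 < r /\
    forall u v : C, unit_disc u -> unit_disc v ->
      Cmod (u - z)%C < r -> Cmod (v - z)%C < r -> f u = f v -> u = v.

(* The Jacobian of h + conj g, as a map of the plane. *)
Definition jacobian (h g : C -> C) (z : C) : R :=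
  Cmod (C_derive h z) ^ 2 - Cmod (C_derive g z) ^ 2.

Definition sense_preserving_on_disc (h g : C -> C) : Prop :=
  forall z : C, unit_disc z -> 0 < jacobian h g z.

(* f belongs to L_H, with canonical representation f = h + conj g. *)
Definition in_LH (f h g : C -> C) : Prop :=
  harmonic_on_disc f /\ canonical_rep f h g /\
  locally_injective_on_disc f /\ sense_preserving_on_disc h g /\
  h 0%C = 0%C /\ C_derive h 0%C = 1%C.

Definition starlike_analytic (h : C -> C) : Prop :=
  analytic_on_disc h /\
  (forall u v : C, unit_disc u -> unit_disc v -> h u = h v -> u = v) /\
  h 0%C = 0%C /\
  (forall (z : C) (t : R), unit_disc z -> 0 <= t <= 1 ->
     exists w : C, unit_disc w /\ h w = (t * h z)%C).

Definition in_LH_starlike (alpha : R) (f h g : C -> C) : Prop :=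
  in_LH f h g /\ Cmod (C_derive g 0%C) = alpha /\ starlike_analytic h.

(* Main.v *)
(** The dilatation [g' / h'] maps the disc into itself, so Schwarz-Pick bounds [|g'| / |h'|] by
    [(alpha + |z|) / (1 + alpha |z|)] and [(alpha - |z|) / (1 - alpha |z|)], and the bounds on
    [|h'|] are the distortion theorem for starlike functions. For the latter, starlikeness makes
    [W z := h^-1 (t h z)] a self-map of the disc, hence [|W z| <= |z|]; letting [t] tend to [1]
    gives [Re (z h' / h) >= 0]. The Schwarz lemma applied to [(z h' - h) / (z h' + h)] confines
    [z h' / h] to the disc with diameter [[(1 - r) / (1 + r), (1 + r) / (1 - r)]], and
    integrating [d log |h| / d log r = Re (z h' / h)] along a ray bounds [|h|].

    The maximum principle is local: at an interior point the leading term of a power series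
    increases the modulus in some direction. *)

Require Import Defs.
From Stdlib Require Import Reals PeanoNat Lra Lia List Classical ClassicalEpsilon.
From Coquelicot Require Import Coquelicot.

Open Scope R_scope.

(** * Complex series *)

(** The obstacle is that analyticity is not at hand where the maximum principle is to act: the
    quotients are singular at the origin, and [W] is only a choice of preimages. Both are handled
    through real functions [q = |F| / |K|]. For these it is enough that [q] is upper semicontinuous
    and, at interior points above the claimed bound, locally constant or exceeded by nearby values.
    Results are kept in product form, such as [|F| <= |z| |K|] or [Re (conj (z h') h) >= 0], so that
    zeros at the origin cause no trouble.

    The weak inequality [Re (z h' / h) >= 0] says exactly that [|z h' - h| <= |z h' + h|], which is
    what the Schwarz lemma takes as input. The constants are those of the Koebe function:
    [(1 + r) / (1 - r)] is [d log / d log r] of [r / (1 - r)^2], whence the exponent 2 for [|h|];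
    one more factor [(1 + r) / (1 - r)] produces the exponent 3 for [|h'|]. That [h'] has no zero
    comes from the positive Jacobian. *)

Definition C_series (u : nat -> C) (l : C) : Prop :=
  @is_series C_AbsRing C_NormedModule u l.

Lemma C_series_ext (u v : nat -> C) (l : C) :
  (forall n, u n = v n) -> C_series u l -> C_series v l.
Proof. exact (is_series_ext u v l). Qed.

Lemma C_series_lin (c : C) (u v : nat -> C) (k l : C) :
  C_series u k -> C_series v l ->
  C_series (fun n => u n + c * v n)%C (k + c * l)%C.
Proof.
intros Hu Hv.
exact (is_series_plus _ _ _ _ Hu (is_series_scal c _ _ Hv)).
Qed.

Lemma C_series_scal (c : C) (u : nat -> C) (l : C) :
  C_series u l -> C_series (fun n => c * u n)%C (c * l)%C.
Proof. exact (is_series_scal c u l). Qed.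

Lemma C_series_tail (u : nat -> C) (l : C) :
  C_series u l -> C_series (fun n => u (S n)) (l - u 0%nat)%C.
Proof.
intros H.
apply is_series_incr_1.
replace (plus _ _) with l; auto.
unfold plus; simpl. ring.
Qed.

Lemma C_series_cons (u : nat -> C) (l : C) :
  C_series (fun n => u (S n)) (l - u 0%nat)%C -> C_series u l.
Proof. exact (is_series_decr_1 u l). Qed.

Lemma C_series_eventually (u : nat -> C) (l : C) (eps : R) :
  C_series u l -> 0 < eps ->
  exists N, forall n, (N <= n)%nat -> Cmod (sum_n u n - l) < eps.
Proof.
intros H He.
destruct (proj1 (filterlim_locally_ball_norm _ _) H (mkposreal eps He)) as [N HN].
exists N. intros n Hn. exact (HN n Hn).
Qed.

Lemma Cmod_sum_n_geom (u : nat -> C) (B : R) (n : nat) :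
  (forall n, Cmod (u n) <= B * (/ 2) ^ n) -> Cmod (sum_n u n) <= 2 * B.
Proof.
intros H.
assert (HB : 0 <= B).
{ generalize (H 0%nat) (Cmod_ge_0 (u 0%nat)). simpl. lra. }
(* Subtracting the remainder of the geometric series makes the bound inductive. *)
enough (Cmod (sum_n u n) <= 2 * B - B * (/ 2) ^ n) as E.
{ generalize (pow_lt (/ 2) n ltac:(lra)). nra. }
induction n as [|n IH].
- rewrite sum_O. generalize (H 0%nat). simpl. lra.
- rewrite sum_Sn. unfold plus; simpl.
  eapply Rle_trans; [apply Cmod_triangle|].
  generalize (H (S n)). simpl. lra.
Qed.

(** The estimate behind the later power series bounds; with [B = 0] it shows that a series of zeros
    has sum zero. *)
Lemma Cmod_C_series_geom (u : nat -> C) (l : C) (B : R) :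
  C_series u l -> (forall n, Cmod (u n) <= B * (/ 2) ^ n) -> Cmod l <= 2 * B.
Proof.
intros H Hu.
apply Rnot_lt_le. intros L.
destruct (C_series_eventually u l (Cmod l - 2 * B) H ltac:(lra)) as [N HN].
specialize (HN N (le_n N)).
generalize (Cmod_sum_n_geom u B N Hu) (Cmod_triangle (sum_n u N) (l - sum_n u N)%C).
replace (sum_n u N + (l - sum_n u N))%C with l by ring.
replace (l - sum_n u N)%C with (- (sum_n u N - l))%C by ring.
rewrite Cmod_opp. lra.
Qed.

Lemma ex_C_series_geom (u : nat -> C) (B : R) :
  (forall n, Cmod (u n) <= B * (/ 2) ^ n) -> exists l, C_series u l.
Proof.
intros H.
assert (E : @ex_series C_AbsRing C_CompleteNormedModule u).
{ apply ex_series_le with (fun n => B * (/ 2) ^ n).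
  - intros n. exact (H n).
  - apply (ex_series_scal B (fun n => (/ 2) ^ n)).
    exists (/ (1 - / 2)). apply is_series_geom. rewrite Rabs_pos_eq; lra. }
destruct E as [l Hl]. exists l. exact Hl.
Qed.

(** Beyond [N] a term is the difference of two consecutive partial sums, each within [1] of [l],
    whence [M + 2]; the finitely many earlier terms are bounded by induction. *)
Lemma C_series_bounded (u : nat -> C) (l : C) :
  C_series u l -> exists M, 0 < M /\ forall n, Cmod (u n) <= M.
Proof.
intros H.
destruct (C_series_eventually u l 1 H ltac:(lra)) as [N HN].
assert (F : forall k, exists M, 0 < M /\ forall n, (n <= k)%nat -> Cmod (u n) <= M).
{ induction k as [|k [M [HM IH]]].
  - exists (Cmod (u 0%nat) + 1). split.
    + generalize (Cmod_ge_0 (u 0%nat)). lra.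
    + intros n Hn. replace n with 0%nat by lia. lra.
  - exists (M + Cmod (u (S k))). generalize (Cmod_ge_0 (u (S k))). intros P.
    split; [lra|]. intros n Hn.
    destruct (Nat.lt_trichotomy n (S k)) as [L|[->|L]]; [| |lia].
    + generalize (IH n ltac:(lia)). lra.
    + lra. }
destruct (F N) as [M [HM FM]].
exists (M + 2). split; [lra|]. intros n.
destruct (Nat.le_gt_cases n N) as [L|L].
- generalize (FM n L). lra.
- destruct n as [|n]; [lia|].
  generalize (HN n ltac:(lia)) (HN (S n) ltac:(lia)).
  rewrite sum_Sn. unfold plus; simpl. intros A1 A2.
  generalize (Cmod_triangle (sum_n u n + u (S n) - l) (- (sum_n u n - l))).
  rewrite Cmod_opp.
  replace (sum_n u n + u (S n) - l + - (sum_n u n - l))%C with (u (S n)) by ring.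
  lra.
Qed.

(** * Local power series expansions *)

Lemma Cmod_lt_of_components (z : C) (e : R) :
  Rabs (fst z) < e -> Rabs (snd z) < e -> Cmod z < 2 * e.
Proof.
intros H1 H2.
eapply Rle_lt_trans; [apply Cmod_2Rmax|].
assert (Rmax (Rabs (fst z)) (Rabs (snd z)) < e) by (apply Rmax_lub_lt; auto).
assert (sqrt 2 <= 2).
{ rewrite <- (sqrt_Rsqr 2) at 2 by lra. apply sqrt_le_1_alt. unfold Rsqr; lra. }
assert (0 <= Rmax (Rabs (fst z)) (Rabs (snd z))).
{ eapply Rle_trans; [apply Rabs_pos|apply Rmax_l]. }
assert (0 <= sqrt 2) by apply sqrt_pos.
nra.
Qed.

Lemma C_derive_of_quadratic_bound (f : C -> C) (z l : C) (B d : R) :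
  0 < d ->
  (forall t : C, Cmod t < d -> Cmod (f (z + t)%C - f z - t * l)%C <= B * Cmod t ^ 2) ->
  C_derive f z = l.
Proof.
intros Hd H. apply is_C_lim_unique.
apply (filterlim_locally_ball_norm (U := C_NormedModule)).
intros [eps He].
(* Neighbourhoods in [C] are squares here: components below [dd] only give a modulus below [2 * dd],
   and both entries of the minimum allow for this factor. *)
set (dd := Rmin (d / 2) (eps / (4 * (Rabs B + 1)))).
assert (PB : 0 < Rabs B + 1) by (generalize (Rabs_pos B); lra).
assert (Hdd : 0 < dd).
{ apply Rmin_pos; [lra|]. apply Rdiv_lt_0_compat; lra. }
enough (K : forall y : C, Rabs (fst y - fst z) < dd -> Rabs (snd y - snd z) < dd -> y <> z ->
  Cmod ((f y - f z) / (y - z) - l) < eps).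
{ exists (mkposreal dd Hdd). intros y [Hy1 Hy2] Hn. exact (K y Hy1 Hy2 Hn). }
intros y Hy1 Hy2 Hn.
assert (Hm : Cmod (y - z) < 2 * dd).
{ apply Cmod_lt_of_components; auto. }
assert (N0 : (y - z)%C <> 0).
{ apply Cminus_eq_contra. auto. }
assert (P := proj1 (Cmod_gt_0 _) N0).
assert (D1 : dd <= d / 2) by apply Rmin_l.
assert (D2 : dd <= eps / (4 * (Rabs B + 1))) by apply Rmin_r.
specialize (H (y - z)%C ltac:(lra)).
replace (z + (y - z))%C with y in H by ring.
replace ((f y - f z) / (y - z) - l)%C with ((f y - f z - (y - z) * l) / (y - z))%C
  by (field; auto).
rewrite Cmod_div by auto.
apply (Rmult_lt_reg_r (Cmod (y - z))); auto.
unfold Rdiv. rewrite Rmult_assoc, Rinv_l by lra. rewrite Rmult_1_r.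
eapply Rle_lt_trans; [exact H|].
assert (X : (Rabs B + 1) * Cmod (y - z) < eps).
{ apply (Rmult_le_compat_l (4 * (Rabs B + 1))) in D2; [|lra].
  replace (4 * (Rabs B + 1) * (eps / (4 * (Rabs B + 1)))) with eps in D2 by (field; lra).
  nra. }
generalize (Rle_abs B). nra.
Qed.

(** Carries a Cauchy estimate along with the series, so that later bounds are explicit in [rho] and
    [M]. The estimate costs half of the radius: the terms of a convergent series are bounded, and
    this is applied at the point [r / 2]. *)
Record expansion (f : C -> C) (c : C) (a : nat -> C) (rho M : R) : Prop := {
  expansion_radius : 0 < rho;
  expansion_const : 0 < M;
  expansion_coef : forall n, Cmod (a n) * rho ^ n <= M;
  expansion_sum : forall x, Cmod x < rho -> C_series (fun n => x ^ n * a n)%C (f (c + x)%C) }.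

Lemma analytic_at_series (f : C -> C) (c : C) :
  analytic_at f c <-> exists (a : nat -> C) r, 0 < r /\
    forall x, Cmod x < r -> C_series (fun n => x ^ n * a n)%C (f (c + x)%C).
Proof.
split; intros (a & r & Hr & H); exists a, r; (split; [exact Hr|]); intros x Hx.
- specialize (H (c + x)%C). replace (c + x - c)%C with x in H by ring. exact (H Hx).
- replace (f x) with (f (c + (x - c))%C) by (f_equal; ring). apply H; auto.
Qed.

Lemma analytic_at_expansion (f : C -> C) (c : C) :
  analytic_at f c <-> exists a rho M, expansion f c a rho M.
Proof.
rewrite analytic_at_series. split.
- intros (a & r & Hr & S).
  destruct (C_series_bounded _ _ (S (RtoC (r / 2)) ltac:(rewrite Cmod_R, Rabs_pos_eq; lra)))
    as (M & HM & B).
  exists a, (r / 2), M. split; [lra|auto| |].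
  + intros n. generalize (B n). rewrite Cmod_mult, Cmod_pow, Cmod_R, Rabs_pos_eq by lra.
    rewrite Rmult_comm. auto.
  + intros x Hx. apply S. lra.
- intros (a & rho & M & [Hr HM Ha Hs]). exists a, rho. auto.
Qed.

Lemma expansion_term (f : C -> C) (c : C) (a : nat -> C) (rho M q : R) :
  expansion f c a rho M -> 0 <= q ->
  forall n, Cmod (a n) * (q * rho) ^ n <= M * q ^ n.
Proof.
intros [Hr HM Ha _] Hq n.
rewrite Rpow_mult_distr.
generalize (Ha n) (pow_le q n Hq). nra.
Qed.

Lemma expansion_bound (f : C -> C) (c : C) (a : nat -> C) (rho M : R) (x : C) :
  expansion f c a rho M -> Cmod x <= rho / 2 -> Cmod (f (c + x)%C) <= 2 * M.
Proof.
intros E Hx. destruct E as [Hr HM Ha Hs] eqn:EE.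
apply (Cmod_C_series_geom _ _ _ (Hs x ltac:(lra))).
intros n. rewrite Cmod_mult, Cmod_pow.
generalize (expansion_term _ _ _ _ _ (/ 2) E ltac:(lra) n).
assert (Cmod x ^ n <= (/ 2 * rho) ^ n).
{ apply pow_incr. split; [apply Cmod_ge_0|lra]. }
generalize (Cmod_ge_0 (a n)). nra.
Qed.

Lemma C_series_single (u : nat -> C) :
  (forall n, u (S n) = 0) -> C_series u (u 0%nat).
Proof.
intros H. apply C_series_cons.
destruct (ex_C_series_geom (fun n => u (S n)) 0) as [l Hl].
{ intros n. rewrite H, Cmod_0. lra. }
replace (u 0%nat - u 0%nat)%C with l; auto.
replace (u 0%nat - u 0%nat)%C with (RtoC 0) by ring.
apply Cmod_eq_0. apply Rle_antisym; [|apply Cmod_ge_0].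
replace 0 with (2 * 0) by ring.
apply (Cmod_C_series_geom _ _ _ Hl). intros n. rewrite H, Cmod_0. lra.
Qed.

Lemma expansion_center (f : C -> C) (c : C) (a : nat -> C) (rho M : R) :
  expansion f c a rho M -> f c = a 0%nat.
Proof.
intros [Hr HM Ha Hs].
assert (H := Hs 0 ltac:(rewrite Cmod_0; lra)).
replace (c + 0)%C with c in H by ring.
apply C_series_tail in H.
assert (E : (f c - a 0%nat)%C = 0).
{ apply Cmod_eq_0. apply Rle_antisym; [|apply Cmod_ge_0].
  replace 0 with (2 * 0) by ring.
  replace (f c - a 0%nat)%C with (f c - RtoC 0 ^ 0 * a 0%nat)%C by (simpl; ring).
  apply (Cmod_C_series_geom _ _ _ H). intros n. simpl.
  replace (RtoC 0 * RtoC 0 ^ n * a (S n))%C with (RtoC 0) by ring. rewrite Cmod_0. lra. }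
replace (f c) with (f c - a 0%nat + a 0%nat)%C by ring. rewrite E. ring.
Qed.

(** [f1] is the difference quotient at [c], its removable singularity filled by [a 1]. Radius and
    form of the bound survive, so the division can be iterated. *)
Lemma expansion_shift (f : C -> C) (c : C) (a : nat -> C) (rho M : R) :
  expansion f c a rho M ->
  exists f1, expansion f1 c (fun n => a (S n)) rho (M / rho) /\
    forall x, Cmod x < rho -> f (c + x)%C = (a 0%nat + x * f1 (c + x)%C)%C.
Proof.
intros E.
exists (fun z => if excluded_middle_informative (z = c) then a 1%nat
                 else ((f z - a 0%nat) / (z - c))%C).
split; [split|].
- apply E.
- destruct E; apply Rdiv_lt_0_compat; auto.
- destruct E as [Hr HM Ha _]. intros n. generalize (Ha (S n)). simpl. intros H.
  apply (Rmult_le_reg_r rho); auto. unfold Rdiv.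
  rewrite (Rmult_assoc M), Rinv_l by lra. lra.
- intros x Hx. destruct excluded_middle_informative as [e|e].
  + replace x with (RtoC 0).
    * replace (a 1%nat) with (RtoC 0 ^ 0 * a 1%nat)%C by (simpl; ring).
      apply (C_series_single (fun n => (RtoC 0 ^ n * a (S n))%C)). intros n. simpl. ring.
    * replace x with (c + x - c)%C by ring. rewrite e. ring.
  + assert (Hx0 : x <> 0). { intros ->. apply e. ring. }
    assert (H := C_series_tail _ _ (expansion_sum _ _ _ _ _ E x Hx)).
    apply (C_series_scal (/ x)) in H.
    replace (_ / _)%C with (/ x * (f (c + x)%C - x ^ 0 * a 0%nat))%C.
    * eapply C_series_ext; [|exact H]. intros n. simpl. field. auto.
    * simpl. replace (c + x - c)%C with x by ring. field; auto.
- intros x Hx. destruct excluded_middle_informative as [e|e].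
  + replace x with (RtoC 0).
    * replace (c + 0)%C with c by ring. rewrite (expansion_center _ _ _ _ _ E). ring.
    * replace x with (c + x - c)%C by ring. rewrite e. ring.
  + replace (c + x - c)%C with x by ring. field. intros ->. apply e. ring.
Qed.

Definition continuous_at (f : C -> C) (c : C) : Prop :=
  forall eps, 0 < eps -> exists d, 0 < d /\
    forall z, Cmod (z - c) < d -> Cmod (f z - f c) < eps.

Lemma analytic_at_continuous (f : C -> C) (c : C) :
  analytic_at f c -> continuous_at f c.
Proof.
intros H. apply analytic_at_expansion in H. destruct H as (a & rho & M & E).
destruct (expansion_shift _ _ _ _ _ E) as (f1 & E1 & H1).
assert (Hr := expansion_radius _ _ _ _ _ E).
assert (HM := expansion_const _ _ _ _ _ E1).
intros eps He; exists (Rmin (rho / 2) (eps / (4 * (M / rho)))); split.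
{ apply Rmin_pos; [lra|apply Rdiv_lt_0_compat; lra]. }
intros z Hz.
assert (Z1 := Rlt_le_trans _ _ _ Hz (Rmin_l _ _)).
assert (Z2 := Rlt_le_trans _ _ _ Hz (Rmin_r _ _)).
replace (f z) with (f (c + (z - c))%C) by (f_equal; ring).
rewrite H1, (expansion_center _ _ _ _ _ E) by lra.
replace (a 0%nat + (z - c) * f1 (c + (z - c))%C - a 0%nat)%C
    with ((z - c) * f1 (c + (z - c)%C)%C)%C by ring.
rewrite Cmod_mult.
generalize (expansion_bound _ _ _ _ _ (z - c)%C E1 ltac:(lra)) (Cmod_ge_0 (z - c)).
apply (Rmult_lt_compat_r (4 * (M / rho))) in Z2; [|lra].
unfold Rdiv at 2 in Z2; rewrite Rmult_assoc, Rinv_l in Z2 by lra.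
nra.
Qed.

(** Induction: the remainder for the next power is [x + t] times the previous one plus
    [(n + 1) t^2 x^n]. The generous factor 4 per step absorbs both this sum and the growth of
    [n + 1]. *)
Lemma pow_remainder (n : nat) (x t : C) (r : R) :
  0 < r -> Cmod x <= r -> Cmod (x + t) <= r ->
  Cmod ((x + t) ^ S n - x ^ S n - t * (INR (S n) * x ^ n))
    <= Cmod t ^ 2 * (4 * r) ^ S n / r ^ 2.
Proof.
intros HR Hx Hxt.
assert (Ht : 0 <= Cmod t ^ 2) by apply pow2_ge_0.
induction n as [|n IH].
- simpl Cpow. replace (INR 1) with 1 by reflexivity.
  match goal with |- Cmod ?e <= _ => replace e with (RtoC 0) by ring end.
  rewrite Cmod_0. apply Rmult_le_pos; [apply Rmult_le_pos|]; auto.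
  + apply pow_le; lra.
  + left. apply Rinv_0_lt_compat, pow_lt; auto.
- replace ((x + t) ^ S (S n) - x ^ S (S n) - t * (INR (S (S n)) * x ^ S n))%C
    with ((x + t) * ((x + t) ^ S n - x ^ S n - t * (INR (S n) * x ^ n))
          + INR (S n) * (t ^ 2 * x ^ n))%C.
  2:{ rewrite (S_INR (S n)), RtoC_plus. simpl Cpow. ring. }
  eapply Rle_trans; [apply Cmod_triangle|].
  rewrite !Cmod_mult, Cmod_R, !Cmod_pow, (Rabs_pos_eq (INR _)) by apply pos_INR.
  assert (P : Cmod x ^ n <= r ^ n) by (apply pow_incr; split; [apply Cmod_ge_0|auto]).
  assert (Q : INR (S n) * Cmod x ^ n <= 4 ^ S n * r ^ n).
  { apply Rmult_le_compat; auto. apply pos_INR. apply pow_le, Cmod_ge_0.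
    clear. induction n as [|n IH]; [simpl; lra|].
    rewrite S_INR. change (4 ^ S (S n)) with (4 * 4 ^ S n).
    generalize (pow_R1_Rle 4 (S n) ltac:(lra)). lra. }
  set (K := Cmod t ^ 2 * (4 * r) ^ S n / r ^ 2) in *.
  replace (Cmod t ^ 2 * (4 * r) ^ S (S n) / r ^ 2) with (4 * r * K)
    by (unfold K; simpl; field; lra).
  assert (K1 : Cmod t ^ 2 * (4 ^ S n * r ^ n) = r * K).
  { unfold K. rewrite Rpow_mult_distr. simpl. field. lra. }
  assert (K0 : 0 <= r * K).
  { rewrite <- K1. apply Rmult_le_pos; auto. apply Rmult_le_pos; apply pow_le; lra. }
  assert (A : Cmod (x + t) * Cmod ((x + t) ^ S n - x ^ S n - t * (INR (S n) * x ^ n)) <= r * K).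
  { apply Rmult_le_compat; auto; apply Cmod_ge_0. }
  assert (A2 : INR (S n) * (Cmod t ^ 2 * Cmod x ^ n) <= r * K).
  { rewrite <- K1. nra. }
  lra.
Qed.

(** Termwise differentiation. With [|x|] and [|x + t|] at most [rho / 8], the [4 * r] of
    [pow_remainder] is [rho / 2], so the remainders form a geometric series of ratio [/ 2]; in [128]
    the factor 64 comes from [(rho / 8) ^ 2] and 2 from that series. The second conclusion is
    uniform in [x], which strict differentiability will use. *)
Lemma expansion_derive (f : C -> C) (c : C) (a : nat -> C) (rho M : R) :
  expansion f c a rho M ->
  expansion (C_derive f) c (fun n => INR (S n) * a (S n))%C (rho / 16) (M / rho) /\
  forall x t, Cmod x <= rho / 16 -> Cmod (x + t) <= rho / 8 ->
    Cmod (f (c + x + t)%C - f (c + x)%C - t * C_derive f (c + x)%C) <= 128 * M / rho ^ 2 * Cmod t ^ 2.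
Proof.
intros E.
assert (Hr := expansion_radius _ _ _ _ _ E).
assert (HM := expansion_const _ _ _ _ _ E).
assert (T : forall q n, 0 <= q -> Cmod (a n) * (q * rho) ^ n <= M * q ^ n).
{ intros q n Hq. exact (expansion_term _ _ _ _ _ q E Hq n). }
assert (I2 : forall n, INR (S n) <= 2 ^ n).
{ induction n as [|n IH]; [simpl; lra|]. rewrite S_INR. simpl pow.
  generalize (pow_R1_Rle 2 n ltac:(lra)). lra. }
assert (CB : forall n, Cmod (INR (S n) * a (S n)) * (rho / 16) ^ n <= M / rho * (/ 8) ^ n).
{ intros n. rewrite Cmod_mult, Cmod_R, Rabs_pos_eq by apply pos_INR.
  generalize (T (/ 16) (S n) ltac:(lra)) (I2 n) (Cmod_ge_0 (a (S n))). intros A1 A2 A3.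
  assert (A4 : Cmod (a (S n)) * (rho / 16) ^ n <= M / rho * (/ 16) ^ n).
  { apply (Rmult_le_reg_r (/ 16 * rho)); [lra|].
    replace (rho / 16) with (/ 16 * rho) by field. simpl in A1.
    replace (M / rho * (/ 16) ^ n * (/ 16 * rho)) with (M * (/ 16 * (/ 16) ^ n)) by (field; lra).
    lra. }
  replace (/ 8) with (2 * / 16) by field. rewrite Rpow_mult_distr.
  assert (0 <= Cmod (a (S n)) * (rho / 16) ^ n) by (apply Rmult_le_pos; auto; apply pow_le; lra).
  generalize (pow_le 2 n ltac:(lra)) (pos_INR (S n)). nra. }
assert (D : forall x, Cmod x <= rho / 16 ->
  exists l, C_series (fun n => x ^ n * (INR (S n) * a (S n)))%C l).
{ intros x Hx. apply (ex_C_series_geom _ (M / rho)). intros n.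
  rewrite Cmod_mult, Cmod_pow.
  assert (Cmod x ^ n <= (rho / 16) ^ n) by (apply pow_incr; split; [apply Cmod_ge_0|lra]).
  assert ((/ 8) ^ n <= (/ 2) ^ n) by (apply pow_incr; lra).
  assert (0 < M / rho) by (apply Rdiv_lt_0_compat; auto).
  generalize (CB n) (Cmod_ge_0 (INR (S n) * a (S n))). nra. }
assert (Q : forall x t l, Cmod x <= rho / 16 -> Cmod (x + t) <= rho / 8 ->
  C_series (fun n => x ^ n * (INR (S n) * a (S n)))%C l ->
  Cmod (f (c + x + t)%C - f (c + x)%C - t * l) <= 128 * M / rho ^ 2 * Cmod t ^ 2).
{ intros x t l Hx Hxt Hl.
  assert (S1 := expansion_sum _ _ _ _ _ E x ltac:(lra)).
  assert (S2 := expansion_sum _ _ _ _ _ E (x + t)%C ltac:(lra)).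
  rewrite Cplus_assoc in S2.
  (* The constant terms cancel; after dropping them the series starts at exponent 1 and lines up
     with the derivative series. *)
  assert (S3 := C_series_tail _ _ (C_series_lin (- (1)) _ _ _ _ S2 S1)).
  cbv beta in S3.
  assert (S4 := C_series_lin (- t) _ _ _ _ S3 Hl).
  replace (f (c + x + t)%C - f (c + x)%C - t * l)%C with
    (f (c + x + t)%C + - (1) * f (c + x)%C - ((x + t) ^ 0 * a 0%nat + - (1) * (x ^ 0 * a 0%nat))
      + - t * l)%C by (simpl; ring).
  replace (128 * M / rho ^ 2 * Cmod t ^ 2)
    with (2 * (64 * M / rho ^ 2 * Cmod t ^ 2)) by (field; lra).
  apply (Cmod_C_series_geom _ _ _ S4). intros n. cbv beta.
  replace ((x + t) ^ S n * a (S n) + - (1) * (x ^ S n * a (S n))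
      + - t * (x ^ n * (INR (S n) * a (S n))))%C
    with (a (S n) * ((x + t) ^ S n - x ^ S n - t * (INR (S n) * x ^ n)))%C by ring.
  rewrite Cmod_mult.
  assert (P := pow_remainder n x t (rho / 8) ltac:(lra) ltac:(lra) Hxt).
  replace (4 * (rho / 8)) with (/ 2 * rho) in P by field.
  replace (Cmod t ^ 2 * (/ 2 * rho) ^ S n / (rho / 8) ^ 2)
    with (64 / rho ^ 2 * Cmod t ^ 2 * (/ 2 * rho) ^ S n) in P by (field; lra).
  generalize (T (/ 2) (S n) ltac:(lra)). intros T1.
  assert (P2 : 0 <= 64 / rho ^ 2 * Cmod t ^ 2).
  { apply Rmult_le_pos; [|apply pow2_ge_0]. left. apply Rdiv_lt_0_compat; [lra|apply pow_lt; auto]. }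
  apply Rle_trans with (64 / rho ^ 2 * Cmod t ^ 2 * (M * (/ 2) ^ S n)).
  - generalize (Cmod_ge_0 (a (S n))). nra.
  - assert (P3 : 0 < (/ 2) ^ n) by (apply pow_lt; lra). simpl pow at 3.
    replace (64 * M / rho ^ 2 * Cmod t ^ 2 * (/ 2) ^ n)
      with (64 / rho ^ 2 * Cmod t ^ 2 * (M * (/ 2) ^ n)) by (field; lra).
    apply Rmult_le_compat_l; auto. nra. }
assert (G : forall x l, Cmod x < rho / 16 ->
  C_series (fun n => x ^ n * (INR (S n) * a (S n)))%C l -> C_derive f (c + x)%C = l).
{ intros x l Hx Hl. apply C_derive_of_quadratic_bound with (128 * M / rho ^ 2) (rho / 16); [lra|].
  intros t Ht. apply Q; auto; [lra|].
  eapply Rle_trans; [apply Cmod_triangle|lra]. }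
split; [split|].
- lra.
- apply Rdiv_lt_0_compat; auto.
- intros n. eapply Rle_trans; [apply CB|].
  assert (0 < M / rho) by (apply Rdiv_lt_0_compat; auto).
  assert ((/ 8) ^ n <= 1 ^ n) by (apply pow_incr; lra). rewrite pow1 in *. nra.
- intros x Hx. destruct (D x ltac:(lra)) as [l Hl]. rewrite (G x l); auto.
- intros x t Hx Hxt. destruct (D x Hx) as [l Hl].
  rewrite (C_derive_of_quadratic_bound f (c + x)%C l (128 * M / rho ^ 2) (rho / 16)); auto; [lra|].
  intros s Hs. apply Q; auto.
  eapply Rle_trans; [apply Cmod_triangle|lra].
Qed.

Lemma analytic_at_lin (k : C) (f g : C -> C) (c : C) :
  analytic_at f c -> analytic_at g c -> analytic_at (fun z => f z + k * g z)%C c.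
Proof.
rewrite !analytic_at_series. intros (a & r & Hr & H) (b & s & Hs & G).
exists (fun n => a n + k * b n)%C, (Rmin r s). split; [apply Rmin_pos; auto|]. intros x Hx.
eapply C_series_ext; [|apply C_series_lin; [apply H|apply G]].
- intros n. simpl. ring.
- exact (Rlt_le_trans _ _ _ Hx (Rmin_l _ _)).
- exact (Rlt_le_trans _ _ _ Hx (Rmin_r _ _)).
Qed.

Lemma analytic_at_mul_id (f : C -> C) (c : C) :
  analytic_at f c -> analytic_at (fun z => z * f z)%C c.
Proof.
rewrite !analytic_at_series. intros (a & r & Hr & H).
exists (fun n => c * a n + match n with O => 0 | S m => a m end)%C, r.
split; auto. intros x Hx. specialize (H x Hx).
assert (H2 : C_series (fun n => x ^ n * match n with O => 0 | S m => a m end)%C (x * f (c + x)%C)%C).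
{ apply C_series_cons.
  replace (x * f (c + x)%C - x ^ 0 * 0)%C with (x * f (c + x)%C)%C by ring.
  eapply C_series_ext; [|exact (C_series_scal x _ _ H)]. intros n. simpl. ring. }
replace ((c + x) * f (c + x)%C)%C with (x * f (c + x)%C + c * f (c + x)%C)%C by ring.
eapply C_series_ext; [|exact (C_series_lin c _ _ _ _ H2 H)]. intros n. simpl. ring.
Qed.

Lemma analytic_at_scale (k : C) (f : C -> C) (c : C) :
  analytic_at f (k * c)%C -> analytic_at (fun z => f (k * z)%C) c.
Proof.
rewrite !analytic_at_series. intros (a & r & Hr & H).
assert (P := Cmod_ge_0 k).
(* The [+ 1] keeps the radius meaningful for [k = 0]. *)
exists (fun n => k ^ n * a n)%C, (r / (Cmod k + 1)).
split; [apply Rdiv_lt_0_compat; lra|]. intros x Hx.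
replace (k * (c + x))%C with (k * c + k * x)%C by ring.
eapply C_series_ext; [|apply (H (k * x)%C)].
- intros n. cbv beta. rewrite Cpow_mult_l. ring.
- rewrite Cmod_mult. apply (Rmult_lt_compat_r (Cmod k + 1)) in Hx; [|lra].
  unfold Rdiv in Hx. rewrite Rmult_assoc, Rinv_l in Hx by lra.
  generalize (Cmod_ge_0 x). nra.
Qed.

Lemma analytic_at_derive (f : C -> C) (c : C) :
  analytic_at f c -> analytic_at (C_derive f) c.
Proof.
intros H. apply analytic_at_expansion in H. destruct H as (a & rho & M & E).
apply analytic_at_expansion. do 3 eexists. exact (proj1 (expansion_derive _ _ _ _ _ E)).
Qed.

Lemma analytic_at_taylor1 (f : C -> C) (c : C) :
  analytic_at f c -> exists B d, 0 <= B /\ 0 < d /\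
    forall x t, Cmod x < d -> Cmod t < d ->
      Cmod (f (c + x + t)%C - f (c + x)%C - t * C_derive f (c + x)%C) <= B * Cmod t ^ 2.
Proof.
intros H. apply analytic_at_expansion in H. destruct H as (a & rho & M & E).
assert (Hr := expansion_radius _ _ _ _ _ E).
assert (HM := expansion_const _ _ _ _ _ E).
exists (128 * M / rho ^ 2), (rho / 16). repeat split; [|lra|].
- left. apply Rdiv_lt_0_compat; [lra|apply pow_lt; auto].
- intros x t Hx Ht. apply (proj2 (expansion_derive _ _ _ _ _ E)); [lra|].
  eapply Rle_trans; [apply Cmod_triangle|lra].
Qed.

Lemma analytic_at_taylor1_center (f : C -> C) (c : C) :
  analytic_at f c -> exists B d, 0 <= B /\ 0 < d /\
    forall t, Cmod t < d ->
      Cmod (f (c + t)%C - f c - t * C_derive f c) <= B * Cmod t ^ 2.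
Proof.
intros H. destruct (analytic_at_taylor1 _ _ H) as (B & d & HB & Hd & T).
exists B, d. repeat split; auto. intros t Ht.
specialize (T 0 t ltac:(rewrite Cmod_0; auto) Ht).
replace (c + 0)%C with c in T by ring. exact T.
Qed.

(** Taylor expansion at [v], with the derivative then moved to [c] by continuity. Letting both
    points vary matters for comparing [h] at [W (c + x)] and at [k * (c + x)], neither of which is
    the centre. *)
Lemma analytic_at_strict_derive (f : C -> C) (c : C) :
  analytic_at f c -> forall eps, 0 < eps -> exists d, 0 < d /\
    forall u v, Cmod (u - c) < d -> Cmod (v - c) < d ->
      Cmod (f u - f v - C_derive f c * (u - v)) <= eps * Cmod (u - v).
Proof.
intros H eps He.
destruct (analytic_at_taylor1 _ _ H) as (B & d & HB & Hd & T).
destruct (analytic_at_continuous _ _ (analytic_at_derive _ _ H) (eps / 2) ltac:(lra))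
  as (d2 & Hd2 & K).
set (d3 := eps / (4 * (B + 1))).
assert (Hd3 : 0 < d3) by (apply Rdiv_lt_0_compat; lra).
exists (Rmin (d / 2) (Rmin d2 d3)). split.
{ repeat apply Rmin_pos; auto; lra. }
intros u v Hu Hv.
assert (U1 := Rlt_le_trans _ _ _ Hu (Rmin_l _ _)).
assert (V1 := Rlt_le_trans _ _ _ Hv (Rmin_l _ _)).
assert (U2 := Rlt_le_trans _ _ _ Hu (Rmin_r _ _)).
assert (V2 := Rlt_le_trans _ _ _ Hv (Rmin_r _ _)).
assert (U3 := Rlt_le_trans _ _ _ U2 (Rmin_r _ _)).
assert (V3 := Rlt_le_trans _ _ _ V2 (Rmin_l _ _)).
assert (V4 := Rlt_le_trans _ _ _ V2 (Rmin_r _ _)).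
assert (A : Cmod (u - v) <= Cmod (u - c) + Cmod (v - c)).
{ replace (u - v)%C with ((u - c) + - (v - c))%C by ring.
  eapply Rle_trans; [apply Cmod_triangle|]. rewrite Cmod_opp. lra. }
specialize (T (v - c)%C (u - v)%C ltac:(lra) ltac:(lra)).
replace (c + (v - c))%C with v in T by ring.
replace (v + (u - v))%C with u in T by ring.
specialize (K v V3).
replace (f u - f v - C_derive f c * (u - v))%C with
  ((f u - f v - (u - v) * C_derive f v) + (u - v) * (C_derive f v - C_derive f c))%C by ring.
eapply Rle_trans; [apply Cmod_triangle|]. rewrite Cmod_mult.
assert (A2 : Cmod (u - v) <= 2 * d3) by lra.
assert (A3 : (B + 1) * (2 * d3) = eps / 2) by (unfold d3; field; lra).
assert (A4 := Cmod_ge_0 (u - v)).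
assert (B * Cmod (u - v) <= eps / 2) by nra.
simpl in T. nra.
Qed.

Lemma analytic_at_factor (f : C -> C) (c : C) :
  analytic_at f c -> f c = 0 -> exists f1 d, 0 < d /\ analytic_at f1 c /\ f1 c = C_derive f c /\
    forall x, Cmod x < d -> f (c + x)%C = (x * f1 (c + x)%C)%C.
Proof.
intros H Z. apply analytic_at_expansion in H. destruct H as (a & rho & M & E).
destruct (expansion_shift _ _ _ _ _ E) as (f1 & E1 & H1).
exists f1, rho. split; [apply E|]. split; [|split].
- apply analytic_at_expansion. eauto.
- rewrite (expansion_center _ _ _ _ _ E1).
  rewrite (expansion_center _ _ _ _ _ (proj1 (expansion_derive _ _ _ _ _ E))). simpl. ring.
- intros x Hx. rewrite H1 by auto. rewrite <- (expansion_center _ _ _ _ _ E), Z. ring.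
Qed.

(** Either all coefficients vanish, or factors [x] are split off until the constant coefficient is
    nonzero; the index of any nonzero coefficient bounds the number of divisions. *)
Lemma analytic_at_leading_term (f : C -> C) (c : C) :
  analytic_at f c ->
  (exists d, 0 < d /\ forall x, Cmod x < d -> f (c + x)%C = 0) \/
  (exists k g d, 0 < d /\ analytic_at g c /\ g c <> 0 /\
    forall x, Cmod x < d -> f (c + x)%C = (x ^ k * g (c + x)%C)%C).
Proof.
intros H. apply analytic_at_expansion in H. destruct H as (a & rho & M & E).
destruct (classic (exists k, a k <> 0)) as [[k Hk]|N].
- right. revert f a M E Hk. induction k as [|k IH]; intros f a M E Hk.
  + exists 0%nat, f, rho. split; [apply E|]. split; [apply analytic_at_expansion; eauto|].
    rewrite (expansion_center _ _ _ _ _ E). split; auto. intros x _. simpl. ring.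
  + destruct (classic (a 0%nat = 0)) as [Z|Z].
    * destruct (expansion_shift _ _ _ _ _ E) as (f1 & E1 & H1).
      destruct (IH f1 _ _ E1 Hk) as (m & g & d & Hd & Ag & Hg & F).
      exists (S m), g, (Rmin d rho). split; [apply Rmin_pos; auto; apply E|].
      split; auto. split; auto. intros x Hx.
      rewrite H1, F, Z by (eapply Rlt_le_trans; [exact Hx|]; auto using Rmin_l, Rmin_r).
      simpl. ring.
    * exists 0%nat, f, rho. split; [apply E|]. split; [apply analytic_at_expansion; eauto|].
      rewrite (expansion_center _ _ _ _ _ E). split; auto. intros x _. simpl. ring.
- left. exists rho. split; [apply E|]. intros x Hx.
  assert (S1 := expansion_sum _ _ _ _ _ E x Hx).
  assert (Z : forall n, a n = 0).
  { intros n. apply NNPP. intros L. apply N. eauto. }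
  apply Cmod_eq_0, Rle_antisym; [|apply Cmod_ge_0].
  replace 0 with (2 * 0) by ring.
  apply (Cmod_C_series_geom _ _ _ S1). intros n. rewrite Z, Cmult_0_r, Cmod_0. lra.
Qed.

(** * The maximum principle *)

Lemma finite_maximal (T : Type) (lt : T -> T -> Prop) (l : list T) :
  (forall x, ~ lt x x) -> (forall x y z, lt x y -> lt y z -> lt x z) -> l <> nil ->
  exists m, In m l /\ forall s, In s l -> ~ lt m s.
Proof.
intros Hi Ht. induction l as [|a [|b l] IH]; intros N.
- contradiction.
- exists a. split; [left; auto|]. intros s [<-|[]]. apply Hi.
- destruct IH as (m & Hm & H); [discriminate|].
  destruct (classic (lt m a)) as [L|L].
  + exists a. split; [left; auto|]. intros s [<-|Hs]; [apply Hi|].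
    intros K. exact (H s Hs (Ht _ _ _ L K)).
  + exists m. split; [right; auto|]. intros s [<-|Hs]; auto.
Qed.

(* Finite cover argument: a maximal one among the finitely many witnesses would itself be
   dominated by another witness. *)
Lemma disc_no_ascent (d : C) (r : R) (lt : C -> C -> Prop) :
  0 <= r -> (forall x, ~ lt x x) -> (forall x y z, lt x y -> lt y z -> lt x z) ->
  ~ (forall t, Cmod (t - d) <= r -> exists e s, 0 < e /\ Cmod (s - d) <= r /\
       forall x, Cmod (x - d) <= r -> Cmod (x - t) < e -> lt x s).
Proof.
intros Hr Hi Ht H.
assert (H' : forall t : C, exists es : R * C, 0 < fst es /\ Cmod (snd es - d) <= r /\
  forall x, Cmod (x - d) <= r -> Cmod (x - t) < fst es -> lt x (snd es)).
{ intros t. destruct (Rle_lt_dec (Cmod (t - d)) r) as [L|L].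
  - destruct (H t L) as (e & s & K). exists (e, s). exact K.
  (* Compactness will be applied to a square. A point outside the disc gets a neighbourhood missing
     the disc, so the witness [d] is a dummy. *)
  - exists (Cmod (t - d) - r, d). simpl. split; [lra|]. split.
    + replace (d - d)%C with (RtoC 0) by ring. rewrite Cmod_0. auto.
    + intros x Hx Hxt. exfalso.
      replace (t - d)%C with ((x - d) + - (x - t))%C in Hxt by ring.
      generalize (Cmod_triangle (x - d) (- (x - t))). rewrite Cmod_opp. lra. }
set (es := fun t => proj1_sig (constructive_indefinite_description _ (H' t))).
assert (Hes : forall t, 0 < fst (es t) /\ Cmod (snd (es t) - d) <= r /\
  forall x, Cmod (x - d) <= r -> Cmod (x - t) < fst (es t) -> lt x (snd (es t))).
{ intros t. unfold es. apply proj2_sig. }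
(* Halved because the cover consists of squares, whose points lie within twice the half-side. *)
assert (Hd : forall t, 0 < fst (es t) / 2) by (intros t; destruct (Hes t); lra).
set (pt := fun t : Compactness.Tn 2 R => (fst t, fst (snd t)) : C).
apply (compactness_list 2 (fst d - r, (snd d - r, tt)) (fst d + r, (snd d + r, tt))
  (fun t => mkposreal _ (Hd (pt t)))).
intros [l Hl].
assert (Cov : forall x : C, Cmod (x - d) <= r -> exists t, In t l /\ lt x (snd (es (pt t)))).
{ intros x Hx.
  assert (B := Rmax_Cmod (x - d)%C). simpl in B.
  assert (B1 := Rle_trans _ _ _ (Rmax_l _ _) B). assert (B2 := Rle_trans _ _ _ (Rmax_r _ _) B).
  destruct (Hl (fst x, (snd x, tt))) as ([t1 [t2 []]] & It & _ & Hc).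
  { simpl. apply Rabs_le_between in B1. apply Rabs_le_between in B2. lra. }
  exists (t1, (t2, tt)). split; auto. apply Hes; auto.
  destruct Hc as (c1 & c2 & _). simpl in c1, c2.
  unfold pt in *; simpl in *.
  set (e := fst (es (t1, t2))) in *.
  replace e with (2 * (e / 2)) by field. apply Cmod_lt_of_components; auto. }
destruct (finite_maximal C lt (map (fun t => snd (es (pt t))) l) Hi Ht) as (m & Hm & Hmax).
- destruct (Cov d) as (t & It & _).
  { replace (d - d)%C with (RtoC 0) by ring. rewrite Cmod_0. auto. }
  destruct l; [contradiction|discriminate].
- apply in_map_iff in Hm. destruct Hm as (t & <- & It).
  destruct (Cov (snd (es (pt t)))) as (t' & It' & L); [apply Hes|].
  apply (Hmax (snd (es (pt t')))); auto.
  apply in_map_iff. eauto.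
Qed.

(** Continuity would be too much: the quotient [|W z| / |z|] will be given the value 1 at the
    origin, above its limit there. *)
Definition usc_at (q : C -> R) (c : C) : Prop :=
  forall eps, 0 < eps -> exists e, 0 < e /\ forall z, Cmod (z - c) < e -> q z < q c + eps.

Definition constant_near (q : C -> R) (c : C) : Prop :=
  exists e, 0 < e /\ forall z, Cmod (z - c) < e -> q z = q c.

Definition increases_near (q : C -> R) (c : C) : Prop :=
  forall e, 0 < e -> exists z, Cmod (z - c) < e /\ q c < q z.

(* Ties between maximum points are broken in favour of the one farthest from the centre, which
   makes an identity theorem unnecessary. *)
Lemma max_principle (d : C) (r K : R) (q : C -> R) :
  0 < r ->
  (forall c, Cmod (c - d) <= r -> usc_at q c) ->
  (forall c, Cmod (c - d) < r -> K < q c -> constant_near q c \/ increases_near q c) ->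
  (forall c, Cmod (c - d) = r -> q c <= K) ->
  forall z, Cmod (z - d) <= r -> q z <= K.
Proof.
intros Hr Hu Hi Hb z Hz. apply Rnot_lt_le. intros L.
apply (disc_no_ascent d r
  (fun x s => q x < q s \/ (q x = q s /\ Cmod (x - d) < Cmod (s - d)))).
- lra.
- intros x; lra.
- intros x y t; lra.
- assert (Up : forall t s, Cmod (t - d) <= r -> Cmod (s - d) <= r -> q t < q s ->
    exists e s, 0 < e /\ Cmod (s - d) <= r /\ forall x, Cmod (x - d) <= r -> Cmod (x - t) < e ->
      q x < q s \/ (q x = q s /\ Cmod (x - d) < Cmod (s - d))).
  { intros t s Ht Hs Q. destruct (Hu t Ht (q s - q t) ltac:(lra)) as (e & He & P).
    exists e, s. repeat split; auto. intros x _ Hx. left. generalize (P x Hx). lra. }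
  (* A point at or below the level [K] is dominated by the supposed counterexample [z]. *)
  intros t Ht. destruct (Rle_lt_dec (q t) K) as [LK|LK].
  { apply (Up t z); auto. lra. }
  destruct (Rle_lt_or_eq_dec _ _ Ht) as [Lt|Et].
  2:{ generalize (Hb t Et). lra. }
  destruct (Hi t Lt LK) as [(e & He & Q)|I].
  (* Where [q] is constant nearby, a step in the outward direction [u] keeps its value and gains
     distance from the centre. At the centre itself any direction is outward. *)
  + assert (Sx : exists u, Cmod u = 1 /\ forall a, 0 <= a -> Cmod (t - d + a * u) = Cmod (t - d) + a).
    { destruct (Ceq_dec (t - d) 0) as [E|E].
      - exists 1. split; [apply Cmod_1|]. intros a Ha. rewrite E, Cmod_0.
        replace (0 + a * 1)%C with (RtoC a) by ring. rewrite Cmod_R, Rabs_pos_eq; lra.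
      - assert (P := proj1 (Cmod_gt_0 _) E).
        assert (R1 : RtoC (Cmod (t - d)) <> 0) by (intros e0; apply RtoC_inj in e0; lra).
        exists ((t - d) / Cmod (t - d))%C. split.
        + rewrite Cmod_div, Cmod_R, Rabs_pos_eq by (auto; lra). field. lra.
        + intros a Ha.
          replace (t - d + a * ((t - d) / Cmod (t - d)))%C
            with (RtoC (1 + a / Cmod (t - d)) * (t - d))%C.
          * rewrite Cmod_mult, Cmod_R, Rabs_pos_eq.
            -- field. lra.
            -- assert (0 <= a / Cmod (t - d)) by (apply Rdiv_le_0_compat; auto). lra.
          * rewrite RtoC_plus, RtoC_div by lra. field. auto. }
    destruct Sx as (u & Hu1 & Hua).
    set (a := Rmin (e / 2) (r - Cmod (t - d))).
    assert (Ha : 0 < a) by (apply Rmin_pos; lra).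
    exists (Rmin e a), (t + a * u)%C. split; [apply Rmin_pos; auto|].
    assert (Ns : Cmod (t + a * u - d) = Cmod (t - d) + a).
    { rewrite <- Hua by lra. f_equal. ring. }
    split.
    * rewrite Ns. generalize (Rmin_r (e / 2) (r - Cmod (t - d))). unfold a. lra.
    * intros x _ Hx. right. rewrite Ns. split.
      -- rewrite Q by (eapply Rlt_le_trans; [exact Hx|apply Rmin_l]).
         symmetry. apply Q. replace (t + a * u - t)%C with (a * u)%C by ring.
         rewrite Cmod_mult, Hu1, Cmod_R, Rabs_pos_eq by lra.
         generalize (Rmin_l (e / 2) (r - Cmod (t - d))). unfold a. lra.
      -- replace (x - d)%C with ((t - d) + (x - t))%C by ring.
         eapply Rle_lt_trans; [apply Cmod_triangle|].
         generalize (Rlt_le_trans _ _ _ Hx (Rmin_r _ _)). lra.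
  + destruct (I (r - Cmod (t - d)) ltac:(lra)) as (s & Hs & Q).
    apply (Up t s); auto.
    replace (s - d)%C with ((t - d) + (s - t))%C by ring.
    eapply Rle_trans; [apply Cmod_triangle|]. lra.
Qed.

Lemma Cpow_cos_sin (x : R) (n : nat) :
  Cpow (cos x, sin x) n = (cos (INR n * x), sin (INR n * x)).
Proof.
induction n as [|n IH].
- simpl. rewrite Rmult_0_l, cos_0, sin_0. reflexivity.
- rewrite Cpow_S, IH, S_INR.
  replace ((INR n + 1) * x) with (x + INR n * x) by ring.
  rewrite cos_plus, sin_plus. unfold Cmult; simpl. f_equal; ring.
Qed.

Lemma unit_polar (u : C) : Cmod u = 1 -> exists x, u = (cos x, sin x).
Proof.
intros H. destruct u as [a b].
assert (E : a * a + b * b = 1).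
{ generalize (Cmod2_alt (a, b)). rewrite H. simpl. lra. }
assert (B : -1 <= a <= 1) by nra.
destruct (Rle_lt_dec 0 b) as [L|L].
- exists (acos a). rewrite cos_acos, sin_acos by auto. f_equal.
  replace (1 - Rsqr a) with (Rsqr b) by (unfold Rsqr; lra). rewrite sqrt_Rsqr; auto.
- exists (- acos a). rewrite cos_neg, sin_neg, cos_acos, sin_acos by auto. f_equal.
  replace (1 - Rsqr a) with (Rsqr (- b)) by (unfold Rsqr; lra). rewrite sqrt_Rsqr; lra.
Qed.

(** Takes for [e] a [k]-th root of [conj u / |u|]. This lets a leading term of order [k] be pointed
    in a prescribed direction. *)
Lemma rotation_to_positive (u : C) (k : nat) :
  (0 < k)%nat -> u <> 0 -> exists e, Cmod e = 1 /\ (e ^ k * u)%C = Cmod u.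
Proof.
intros Hk Hu. assert (P := proj1 (Cmod_gt_0 _) Hu).
assert (R1 : RtoC (Cmod u) <> 0) by (intros e0; apply RtoC_inj in e0; lra).
assert (Nk : INR k <> 0) by (apply not_0_INR; lia).
destruct (unit_polar (u / Cmod u)) as [x Hx].
{ rewrite Cmod_div, Cmod_R, Rabs_pos_eq by (auto; lra). field. lra. }
assert (U : forall y, Cmod (cos y, sin y) = 1).
{ intros y. unfold Cmod; simpl.
  replace (_ + _) with (Rsqr (sin y) + Rsqr (cos y)) by (unfold Rsqr; ring).
  rewrite sin2_cos2. apply sqrt_1. }
exists (cos (- x / INR k), sin (- x / INR k)). split; auto.
rewrite Cpow_cos_sin. replace (INR k * (- x / INR k)) with (- x) by (field; auto).
replace u with (Cmod u * (u / Cmod u))%C at 1 by (field; auto).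
rewrite Hx, cos_neg, sin_neg. unfold Cmult, RtoC; simpl. f_equal; [|ring].
generalize (sin2_cos2 x). unfold Rsqr. intros E.
replace (Cmod u) with (Cmod u * 1) at 3 by ring. rewrite <- E. ring.
Qed.

Lemma Cmod_plus_sqr (y v : C) :
  Cmod (y + v) ^ 2 = Cmod y ^ 2 + 2 * Re (Cconj y * v) + Cmod v ^ 2.
Proof. rewrite !Cmod2_alt. destruct y, v; simpl. ring. Qed.

(** Choose the argument of [x] so that the leading deviation [b x^n] points along [k Z c]; then
    [|W|^2] exceeds [|k Z|^2] by a positive cross term. Only an asymptotic expansion of [W] is
    assumed, so a mere choice of preimages qualifies. *)
Lemma modulus_increases (W Z : C -> C) (c k b : C) (n : nat) :
  continuous_at Z c -> k <> 0 -> Z c <> 0 -> b <> 0 -> (0 < n)%nat ->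
  (forall eta, 0 < eta -> exists e, 0 < e /\ forall x, Cmod x < e ->
     Cmod (W (c + x)%C - k * Z (c + x)%C - b * x ^ n)%C <= eta * Cmod x ^ n) ->
  forall e, 0 < e -> exists x, Cmod x < e /\ Cmod k * Cmod (Z (c + x)%C) < Cmod (W (c + x)%C).
Proof.
intros HZ Hk HZ0 Hb Hn HW e He.
assert (Pb := proj1 (Cmod_gt_0 _) Hb).
assert (Pk := proj1 (Cmod_gt_0 _) Hk).
assert (PZ := proj1 (Cmod_gt_0 _) HZ0).
(* With 1/4 here and 1/8 in the next line, the variation of [Z] and the error of the expansion each
   cost at most a quarter of the main cross term. *)
destruct (HZ (Cmod (Z c) / 4) ltac:(lra)) as (e1 & He1 & H1).
destruct (HW (Cmod b / 8) ltac:(lra)) as (e2 & He2 & H2).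
destruct (rotation_to_positive (b * Cconj (k * Z c)) n Hn) as (u & Hu & Eu).
{ apply Cmod_gt_0. rewrite Cmod_mult, Cmod_conj, Cmod_mult.
  repeat apply Rmult_lt_0_compat; auto. }
rewrite Cmod_mult, Cmod_conj, Cmod_mult in Eu.
set (p := Rmin e (Rmin e1 e2) / 2).
assert (Q : 0 < Rmin e (Rmin e1 e2)) by (repeat apply Rmin_pos; auto).
assert (Q1 : Rmin e (Rmin e1 e2) <= e) by apply Rmin_l.
assert (Q2 : Rmin e (Rmin e1 e2) <= e1) by (eapply Rle_trans; [apply Rmin_r|apply Rmin_l]).
assert (Q3 : Rmin e (Rmin e1 e2) <= e2) by (eapply Rle_trans; [apply Rmin_r|apply Rmin_r]).
assert (Hp : 0 < p) by (unfold p; lra).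
exists (p * u)%C.
assert (Mx : Cmod (p * u) = p) by (rewrite Cmod_mult, Hu, Cmod_R, Rabs_pos_eq; lra).
split; [rewrite Mx; unfold p; lra|].
specialize (H1 (c + p * u)%C). specialize (H2 (p * u)%C).
replace (c + p * u - c)%C with (p * u)%C in H1 by ring.
rewrite Mx in H1, H2. specialize (H1 ltac:(unfold p; lra)). specialize (H2 ltac:(unfold p; lra)).
set (Z0 := Z c) in *. set (Z1 := Z (c + p * u)%C) in *. set (W1 := W (c + p * u)%C) in *.
set (E := (W1 - k * Z1 - b * (p * u) ^ n)%C) in *.
assert (Pn : 0 < p ^ n) by (apply pow_lt; auto).
assert (T1 : Cmod Z1 <= 2 * Cmod Z0).
{ replace Z1 with (Z0 + (Z1 - Z0))%C by ring.
  eapply Rle_trans; [apply Cmod_triangle|]. lra. }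
assert (R0 : Re (Cconj (k * Z1) * (b * (p * u) ^ n + E)) =
  p ^ n * (Cmod b * (Cmod k * Cmod Z0)) + Re (Cconj (k * (Z1 - Z0)) * (b * (p * u) ^ n))
  + Re (Cconj (k * Z1) * E)).
{ replace (Cconj (k * Z1) * (b * (p * u) ^ n + E))%C with
    (RtoC (p ^ n) * (u ^ n * (b * Cconj (k * Z0))) + Cconj (k * (Z1 - Z0)) * (b * (p * u) ^ n)
     + Cconj (k * Z1) * E)%C.
  - rewrite Eu, !re_plus, re_scal_l, re_RtoC. reflexivity.
  - rewrite Cpow_mult_l, RtoC_pow, !Cmult_conj, Cminus_conj. ring. }
assert (R1 := re_le_Cmod (Cconj (k * (Z1 - Z0)) * (b * (p * u) ^ n))).
assert (R2 := re_le_Cmod (Cconj (k * Z1) * E)).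
rewrite Cmod_mult, Cmod_conj, Cmod_mult in R1, R2.
rewrite (Cmod_mult b), Cmod_pow, Mx in R1.
apply Rabs_le_between in R1. apply Rabs_le_between in R2.
assert (S1 : Cmod k * Cmod (Z1 - Z0) * (Cmod b * p ^ n) <= / 4 * (p ^ n * (Cmod b * (Cmod k * Cmod Z0)))).
{ apply Rle_trans with (Cmod k * (Cmod Z0 / 4) * (Cmod b * p ^ n)); [|right; field].
  apply Rmult_le_compat_r; [nra|]. apply Rmult_le_compat_l; lra. }
assert (S2 : Cmod k * Cmod Z1 * Cmod E <= / 4 * (p ^ n * (Cmod b * (Cmod k * Cmod Z0)))).
{ apply Rle_trans with (Cmod k * (2 * Cmod Z0) * (Cmod b / 8 * p ^ n)); [|right; field].
  apply Rmult_le_compat; auto; try apply Cmod_ge_0.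
  - apply Rmult_le_pos; apply Cmod_ge_0.
  - apply Rmult_le_compat_l; lra. }
assert (S3 : 0 < p ^ n * (Cmod b * (Cmod k * Cmod Z0))).
{ repeat apply Rmult_lt_0_compat; auto. }
assert (F : Cmod W1 ^ 2 = Cmod (k * Z1) ^ 2 + 2 * Re (Cconj (k * Z1) * (b * (p * u) ^ n + E))
  + Cmod (b * (p * u) ^ n + E) ^ 2).
{ rewrite <- Cmod_plus_sqr. f_equal. f_equal. unfold E. ring. }
rewrite <- Cmod_mult.
generalize (pow2_ge_0 (Cmod (b * (p * u) ^ n + E))) (Cmod_ge_0 W1) (Cmod_ge_0 (k * Z1)).
intros. apply Rnot_le_lt. intros L. assert (Cmod W1 ^ 2 <= Cmod (k * Z1) ^ 2) by (apply pow_incr; auto).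
lra.
Qed.

Lemma continuous_at_neq_0 (Z : C -> C) (c : C) :
  continuous_at Z c -> Z c <> 0 -> exists e, 0 < e /\ forall z, Cmod (z - c) < e -> Z z <> 0.
Proof.
intros H N. destruct (H (Cmod (Z c)) (proj1 (Cmod_gt_0 _) N)) as (e & He & P).
exists e. split; auto. intros z Hz E. specialize (P z Hz). rewrite E in P.
replace (0 - Z c)%C with (- Z c)%C in P by ring. rewrite Cmod_opp in P. lra.
Qed.

Lemma usc_at_ratio (W Z : C -> C) (c : C) (q : C -> R) (e0 : R) :
  continuous_at W c -> continuous_at Z c -> Z c <> 0 -> 0 < e0 ->
  (forall z, Cmod (z - c) < e0 -> q z = Cmod (W z) / Cmod (Z z)) -> usc_at q c.
Proof.
intros HW HZ N He0 Hq eps He.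
assert (P := proj1 (Cmod_gt_0 _) N).
assert (E : q c = Cmod (W c) / Cmod (Z c)).
{ apply Hq. replace (c - c)%C with (RtoC 0) by ring. rewrite Cmod_0. auto. }
assert (Q : 0 <= q c) by (rewrite E; apply Rdiv_le_0_compat; auto; apply Cmod_ge_0).
(* Solves [|W c| + eta = (q c + eps) * (|Z c| - eta)]. *)
set (eta := eps * Cmod (Z c) / (1 + q c + eps)).
assert (Heta : 0 < eta) by (apply Rdiv_lt_0_compat; [apply Rmult_lt_0_compat|]; lra).
assert (Eeta : eta * (1 + q c + eps) = eps * Cmod (Z c)) by (unfold eta; field; lra).
destruct (HW eta Heta) as (e1 & He1 & H1). destruct (HZ eta Heta) as (e2 & He2 & H2).
exists (Rmin e0 (Rmin e1 e2)). split; [repeat apply Rmin_pos; auto|].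
intros z Hz.
specialize (H1 z (Rlt_le_trans _ _ _ Hz (Rle_trans _ _ _ (Rmin_r _ _) (Rmin_l _ _)))).
specialize (H2 z (Rlt_le_trans _ _ _ Hz (Rle_trans _ _ _ (Rmin_r _ _) (Rmin_r _ _)))).
rewrite (Hq z (Rlt_le_trans _ _ _ Hz (Rmin_l _ _))).
assert (T1 : Cmod (W z) < Cmod (W c) + eta).
{ replace (W z) with (W c + (W z - W c))%C by ring.
  eapply Rle_lt_trans; [apply Cmod_triangle|]. lra. }
assert (T2 : Cmod (Z c) - eta < Cmod (Z z)).
{ generalize (Cmod_triangle (Z z) (- (Z z - Z c))). rewrite Cmod_opp.
  replace (Z z + - (Z z - Z c))%C with (Z c) by ring. lra. }
assert (T3 : Cmod (W c) = q c * Cmod (Z c)) by (rewrite E; field; lra).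
assert (eta < Cmod (Z c)) by nra.
apply (Rmult_lt_reg_r (Cmod (Z z))); [lra|].
unfold Rdiv. rewrite Rmult_assoc, Rinv_l by lra. nra.
Qed.

(** Apply the leading term alternative to [F - k K], with [k] the value of the quotient at [c]: if
    it vanishes near [c], the ratio has constant modulus; otherwise its order is positive and the
    modulus can be increased. *)
Lemma analytic_ratio_dichotomy (F K : C -> C) (c : C) (q : C -> R) (e0 : R) :
  analytic_at F c -> analytic_at K c -> K c <> 0 -> F c <> 0 -> 0 < e0 ->
  (forall z, Cmod (z - c) < e0 -> q z = Cmod (F z) / Cmod (K z)) ->
  constant_near q c \/ increases_near q c.
Proof.
intros HF HK NK NF He0 Hq.
assert (PK := proj1 (Cmod_gt_0 _) NK).
set (k := (F c / K c)%C).
assert (Nk : k <> 0).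
{ apply Cmod_gt_0. unfold k. rewrite Cmod_div by auto. apply Rdiv_lt_0_compat; auto.
  apply Cmod_gt_0; auto. }
assert (E : q c = Cmod k).
{ unfold k. rewrite Cmod_div by auto. apply Hq. replace (c - c)%C with (RtoC 0) by ring.
  rewrite Cmod_0. auto. }
destruct (continuous_at_neq_0 _ _ (analytic_at_continuous _ _ HK) NK) as (e1 & He1 & N1).
assert (HG := analytic_at_lin (- k) _ _ _ HF HK).
destruct (analytic_at_leading_term _ _ HG) as [(d & Hd & Z)|(n & g & d & Hd & Hg & Ng & Z)].
- left. exists (Rmin d (Rmin e0 e1)). split; [repeat apply Rmin_pos; auto|].
  intros z Hz.
  specialize (Z (z - c)%C (Rlt_le_trans _ _ _ Hz (Rmin_l _ _))).
  replace (c + (z - c))%C with z in Z by ring. cbv beta in Z.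
  rewrite Hq, E by exact (Rlt_le_trans _ _ _ Hz (Rle_trans _ _ _ (Rmin_r _ _) (Rmin_l _ _))).
  assert (Nz : K z <> 0)
    by exact (N1 z (Rlt_le_trans _ _ _ Hz (Rle_trans _ _ _ (Rmin_r _ _) (Rmin_r _ _)))).
  replace (F z) with (F z + - k * K z + k * K z)%C by ring. rewrite Z, Cplus_0_l, Cmod_mult.
  field. generalize (proj1 (Cmod_gt_0 _) Nz). lra.
- right. assert (Hn : (0 < n)%nat).
  { destruct n; [|lia]. exfalso. specialize (Z 0 ltac:(rewrite Cmod_0; auto)).
    replace (c + 0)%C with c in Z by ring. apply Ng. simpl in Z.
    replace (g c) with (1 * g c)%C by ring. rewrite <- Z. unfold k. field. auto. }
  intros e He.
  destruct (modulus_increases F K c k (g c) n) with (e := Rmin e (Rmin e0 e1)) as (x & Hx & L); auto.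
  + apply analytic_at_continuous; auto.
  + intros eta Heta. destruct (analytic_at_continuous _ _ Hg eta Heta) as (e2 & He2 & H2).
    exists (Rmin d e2). split; [apply Rmin_pos; auto|]. intros x Hx.
    specialize (Z x (Rlt_le_trans _ _ _ Hx (Rmin_l _ _))).
    specialize (H2 (c + x)%C). replace (c + x - c)%C with x in H2 by ring.
    specialize (H2 (Rlt_le_trans _ _ _ Hx (Rmin_r _ _))).
    replace (F (c + x)%C - k * K (c + x)%C - g c * x ^ n)%C
      with ((F (c + x)%C + - k * K (c + x)%C) - g c * x ^ n)%C by ring.
    cbv beta in Z. rewrite Z.
    replace (x ^ n * g (c + x)%C - g c * x ^ n)%C with (x ^ n * (g (c + x)%C - g c))%C by ring.
    rewrite Cmod_mult, Cmod_pow. generalize (pow_le (Cmod x) n (Cmod_ge_0 x)). nra.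
  + repeat apply Rmin_pos; auto.
  + assert (A : Cmod (c + x - c) < Rmin e (Rmin e0 e1)).
    { replace (c + x - c)%C with x by ring. auto. }
    exists (c + x)%C. split; [exact (Rlt_le_trans _ _ _ A (Rmin_l _ _))|].
    rewrite (Hq (c + x)%C), E by exact (Rlt_le_trans _ _ _ A (Rle_trans _ _ _ (Rmin_r _ _) (Rmin_l _ _))).
    assert (Nz : K (c + x)%C <> 0)
      by exact (N1 _ (Rlt_le_trans _ _ _ A (Rle_trans _ _ _ (Rmin_r _ _) (Rmin_r _ _)))).
    assert (Pz := proj1 (Cmod_gt_0 _) Nz).
    apply (Rmult_lt_reg_r (Cmod (K (c + x)%C))); auto.
    unfold Rdiv. rewrite Rmult_assoc, Rinv_l by lra. lra.
Qed.

(** * Open mapping and the Schwarz lemma *)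

Lemma Cminus_diag (c : C) : (c - c)%C = 0.
Proof. ring. Qed.

(** If [y] were omitted near [c], then [- |f - y|] would obey the maximum principle, since a small
    Newton step towards [y] always reduces the distance. But [|f - y|] is smaller at [c] than on a
    circle around it. *)
Lemma analytic_open_at (f : C -> C) (c : C) (r0 eps : R) :
  0 < r0 -> 0 < eps ->
  (forall z, Cmod (z - c) < r0 -> analytic_at f z /\ C_derive f z <> 0) ->
  exists d, 0 < d /\ forall y, Cmod (y - f c) < d -> exists u, Cmod (u - c) < eps /\ f u = y.
Proof.
intros Hr0 Heps H.
destruct (H c) as [Hc Nc]; [rewrite Cminus_diag, Cmod_0; auto|].
set (m := C_derive f c) in *.
assert (Pm := proj1 (Cmod_gt_0 _) Nc).
destruct (analytic_at_strict_derive _ _ Hc (Cmod m / 2) ltac:(lra)) as (d1 & Hd1 & S1).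
fold m in S1.
set (r := Rmin eps (Rmin r0 d1) / 2).
assert (Q : 0 < Rmin eps (Rmin r0 d1)) by (repeat apply Rmin_pos; auto).
assert (Q1 : Rmin eps (Rmin r0 d1) <= eps) by apply Rmin_l.
assert (Q2 : Rmin eps (Rmin r0 d1) <= r0) by (eapply Rle_trans; [apply Rmin_r|apply Rmin_l]).
assert (Q3 : Rmin eps (Rmin r0 d1) <= d1) by (eapply Rle_trans; [apply Rmin_r|apply Rmin_r]).
assert (Hr : 0 < r /\ r < eps /\ r < r0 /\ r < d1) by (unfold r; lra).
exists (Cmod m * r / 4). split; [apply Rdiv_lt_0_compat; [nra|lra]|].
intros y Hy. apply NNPP. intros N.
assert (N' : forall u, Cmod (u - c) <= r -> 0 < Cmod (f u - y)).
{ intros u Hu. apply Cmod_gt_0. intros E. apply N. exists u. split; [lra|].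
  replace (f u) with (f u - y + y)%C by ring. rewrite E. ring. }
enough (K : - Cmod (f c - y) <= - (Cmod m * r / 4)).
{ replace (f c - y)%C with (- (y - f c))%C in K by ring. rewrite Cmod_opp in K. lra. }
apply (max_principle c r (- (Cmod m * r / 4)) (fun u => - Cmod (f u - y))).
- lra.
- intros t Ht e He. destruct (analytic_at_continuous _ _ (proj1 (H t ltac:(lra))) e He)
    as (e1 & He1 & K). exists e1. split; auto. intros z Hz. specialize (K z Hz).
  generalize (Cmod_triangle (f z - y) (- (f z - f t))). rewrite Cmod_opp.
  replace (f z - y + - (f z - f t))%C with (f t - y)%C by ring. lra.
- intros t Ht _. right. intros e He.
  destruct (H t ltac:(lra)) as [At Nt]. set (l := C_derive f t) in *.
  assert (Pl := proj1 (Cmod_gt_0 _) Nt).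
  destruct (analytic_at_taylor1_center _ _ At) as (B & d & HB & Hd & T). fold l in T.
  assert (PD := N' t ltac:(lra)).
  set (D := Cmod (f t - y)) in *.
  set (k := D / Cmod l).
  assert (Pk : 0 < k) by (apply Rdiv_lt_0_compat; auto).
  (* Damping of the Newton step [(y - f t) / l], whose length is [k]: the step must stay in both
     neighbourhoods, and its quadratic error [B (tau k)^2] must lie below the gain [tau D]. *)
  set (tau := Rmin 1 (Rmin (Rmin e d / (2 * k)) (D / (2 * (B + 1) * k ^ 2)))).
  assert (Pe : 0 < Rmin e d) by (apply Rmin_pos; auto).
  assert (Pk2 : 0 < k ^ 2) by (apply pow_lt; auto).
  assert (Ptau : 0 < tau).
  { repeat apply Rmin_pos; [lra|apply Rdiv_lt_0_compat; lra|apply Rdiv_lt_0_compat; nra]. }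
  assert (t1 : tau <= 1) by apply Rmin_l.
  assert (t2 : tau <= Rmin e d / (2 * k)) by (eapply Rle_trans; [apply Rmin_r|apply Rmin_l]).
  assert (t3 : tau <= D / (2 * (B + 1) * k ^ 2)) by (eapply Rle_trans; [apply Rmin_r|apply Rmin_r]).
  apply (Rmult_le_compat_r (2 * k)) in t2; [|lra].
  replace (Rmin e d / (2 * k) * (2 * k)) with (Rmin e d) in t2 by (field; lra).
  apply (Rmult_le_compat_r (2 * (B + 1) * k ^ 2)) in t3; [|nra].
  replace (D / (2 * (B + 1) * k ^ 2) * (2 * (B + 1) * k ^ 2)) with D in t3 by (field; split; lra).
  assert (e1 : Rmin e d <= e) by apply Rmin_l. assert (e2 : Rmin e d <= d) by apply Rmin_r.
  set (s := (tau * ((y - f t) / l))%C).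
  assert (Ms : Cmod s = tau * k).
  { unfold s, k, D. rewrite Cmod_mult, Cmod_div, Cmod_R, Rabs_pos_eq by (auto; lra).
    replace (y - f t)%C with (- (f t - y))%C by ring. rewrite Cmod_opp. reflexivity. }
  exists (t + s)%C. split.
  { replace (t + s - t)%C with s by ring. rewrite Ms. nra. }
  specialize (T s ltac:(rewrite Ms; nra)). rewrite Ms in T.
  replace (f (t + s)%C - y)%C with ((f (t + s)%C - f t - s * l) + RtoC (1 - tau) * (f t - y))%C.
  2:{ unfold s. rewrite RtoC_minus. field. auto. }
  apply Ropp_lt_contravar. eapply Rle_lt_trans; [apply Cmod_triangle|].
  rewrite (Cmod_mult (RtoC _)), Cmod_R, Rabs_pos_eq by lra. fold D.
  assert (tau * (B * tau * k ^ 2) < tau * D) by (apply Rmult_lt_compat_l; nra).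
  replace (B * (tau * k) ^ 2) with (tau * (B * tau * k ^ 2)) in T by ring. lra.
(* On the circle [f u] is at least [|m| r / 2] away from [f c], while [y] is within [|m| r / 4] of
   [f c]. *)
- intros u Hu.
  assert (S2 := S1 u c ltac:(lra) ltac:(rewrite Cminus_diag, Cmod_0; auto)).
  rewrite Hu in S2.
  assert (A1 := Cmod_triangle (f u - y) (- (f u - f c - m * (u - c)) + - (f c - y))).
  replace (f u - y + (- (f u - f c - m * (u - c)) + - (f c - y)))%C with (m * (u - c))%C in A1 by ring.
  assert (A2 := Cmod_triangle (- (f u - f c - m * (u - c))) (- (f c - y))).
  rewrite Cmod_opp in A2. replace (- (f c - y))%C with (y - f c)%C in A1, A2 by ring.
  rewrite Cmod_mult, Hu in A1. lra.
- rewrite Cminus_diag, Cmod_0. lra.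
Qed.

(** The maximum principle on the disc of radius [s] loses a factor [1 / s]; this lets [s] tend to
    1. *)
Lemma le_of_forall_radius (a b r : R) :
  0 <= a -> r < 1 -> (forall s, r < s < 1 -> a * s <= b) -> a <= b.
Proof.
intros Ha Hr H. apply Rnot_lt_le. intros L.
set (s := Rmax ((r + 1) / 2) ((a + b) / (2 * a))).
assert (S1 : (r + 1) / 2 <= s) by apply Rmax_l.
assert (S2 : (a + b) / (2 * a) <= s) by apply Rmax_r.
assert (Pa : 0 < a).
{ destruct Ha as [Ha|Ha]; auto. specialize (H ((r + 1) / 2) ltac:(lra)). rewrite <- Ha in *. lra. }
assert (E : (a + b) / (2 * a) * (2 * a) = a + b) by (field; lra).
assert (S3 : s < 1).
{ apply Rmax_lub_lt; [lra|]. apply (Rmult_lt_reg_r (2 * a)); lra. }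
specialize (H s ltac:(lra)). nra.
Qed.

Lemma continuous_at_id (c : C) : continuous_at (fun z => z) c.
Proof. intros eps He. exists eps. auto. Qed.

(* The Schwarz lemma for [F / K], stated without division; [F1] and [K1] are what remains of
   [F] and [K] at the origin after removing [e z * z] and [e z]. *)
Lemma schwarz_ratio (F K e F1 K1 : C -> C) (d : R) :
  (forall z, unit_disc z -> z <> 0 -> analytic_at F z /\ analytic_at K z /\ K z <> 0) ->
  (forall z, unit_disc z -> Cmod (F z) <= Cmod (K z)) ->
  analytic_at F1 0 -> analytic_at K1 0 -> K1 0%C <> 0 -> 0 < d ->
  (forall z, Cmod z < d -> F z = (e z * z * F1 z)%C /\ K z = (e z * K1 z)%C) ->
  forall z, unit_disc z -> Cmod (F z) <= Cmod z * Cmod (K z).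
Proof.
intros HA HB A1 A2 N1 Hd HE z Hz. unfold unit_disc in *.
destruct (Ceq_dec z 0) as [->|Nz].
{ rewrite (proj1 (HE 0 ltac:(rewrite Cmod_0; auto))), Cmult_0_r, Cmult_0_l, Cmod_0. lra. }
apply le_of_forall_radius with (Cmod z); auto using Cmod_ge_0.
intros r [Hzr Hr1].
assert (Pz := proj1 (Cmod_gt_0 _) Nz).
(* The modulus of [F z / (z K z)], whose value at the origin is what remains after cancelling
   [e z * z]. *)
set (q := fun z : C => if excluded_middle_informative (z = 0) then Cmod (F1 0%C) / Cmod (K1 0%C)
          else Cmod (F z) / Cmod (z * K z)).
assert (q0 : forall x : C, Cmod (x - 0) < Rmin d 1 -> q x = Cmod (F1 x) / Cmod (K1 x)).
{ intros x Hx. replace (x - 0)%C with x in Hx by ring. unfold q.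
  destruct excluded_middle_informative as [->|Nx]; auto.
  destruct (HE x (Rlt_le_trans _ _ _ Hx (Rmin_l _ _))) as [E1 E2].
  destruct (HA x (Rlt_le_trans _ _ _ Hx (Rmin_r _ _)) Nx) as (_ & _ & Nk).
  rewrite E1. rewrite E2 in Nk |- *. rewrite !Cmod_mult.
  apply Cmod_gt_0 in Nk. rewrite Cmod_mult in Nk. apply Cmod_gt_0 in Nx.
  assert (Cmod (e x) <> 0) by nra. assert (Cmod (K1 x) <> 0) by nra. field. lra. }
assert (q1 : forall x c : C, c <> 0 -> Cmod (x - c) < Cmod c -> q x = Cmod (F x) / Cmod (x * K x)).
{ intros x c Nc Hx. unfold q. destruct excluded_middle_informative as [->|]; auto.
  replace (0 - c)%C with (- c)%C in Hx by ring. rewrite Cmod_opp in Hx. lra. }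
assert (L : q z <= 1 / r).
{ apply (max_principle 0 r); [lra| | | |replace (z - 0)%C with z by ring; lra].
  - intros c Hc. replace (c - 0)%C with c in Hc by ring.
    destruct (Ceq_dec c 0) as [->|Nc].
    + apply (usc_at_ratio F1 K1) with (Rmin d 1); auto using analytic_at_continuous.
      apply Rmin_pos; lra.
    + destruct (HA c ltac:(lra) Nc) as (Fc & Kc & Nk).
      apply (usc_at_ratio F (fun x => x * K x)%C) with (Cmod c).
      * auto using analytic_at_continuous.
      * apply analytic_at_continuous, analytic_at_mul_id; auto.
      * apply Cmult_neq_0; auto.
      * apply Cmod_gt_0; auto.
      * intros x Hx. apply q1 with c; auto.
  - intros c Hc Hq. replace (c - 0)%C with c in Hc by ring.
    assert (Pq : 0 < 1 / r) by (apply Rdiv_lt_0_compat; lra).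
    destruct (Ceq_dec c 0) as [->|Nc].
    + apply (analytic_ratio_dichotomy F1 K1) with (Rmin d 1); auto.
      (* A zero of the numerator would put [q] at 0, below the level [1 / r]. *)
      * intros E. rewrite q0, E, Cmod_0 in Hq; [unfold Rdiv in Hq; lra|].
        rewrite Cminus_diag, Cmod_0. apply Rmin_pos; lra.
      * apply Rmin_pos; lra.
    + destruct (HA c ltac:(lra) Nc) as (Fc & Kc & Nk).
      assert (Pc := proj1 (Cmod_gt_0 _) Nc).
      apply (analytic_ratio_dichotomy F (fun x => x * K x)%C) with (Cmod c); auto.
      * apply analytic_at_mul_id; auto.
      * apply Cmult_neq_0; auto.
      * intros E. rewrite (q1 c c), E, Cmod_0 in Hq; auto; [unfold Rdiv in Hq; lra|].
        rewrite Cminus_diag, Cmod_0. auto.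
      * intros x Hx. apply q1 with c; auto.
  - intros c Hc. replace (c - 0)%C with c in Hc by ring.
    assert (Nc : c <> 0) by (apply Cmod_gt_0; lra).
    rewrite (q1 c c) by (auto; rewrite Cminus_diag, Cmod_0; lra).
    destruct (HA c ltac:(lra) Nc) as (_ & _ & Nk). apply Cmod_gt_0 in Nk.
    rewrite Cmod_mult, Hc. generalize (HB c ltac:(lra)). intros B.
    apply (Rmult_le_reg_r (r * Cmod (K c))); [nra|].
    replace (Cmod (F c) / (r * Cmod (K c)) * (r * Cmod (K c))) with (Cmod (F c)) by (field; lra).
    replace (1 / r * (r * Cmod (K c))) with (Cmod (K c)) by (field; lra). auto. }
rewrite (q1 z z) in L by (auto; rewrite Cminus_diag, Cmod_0; lra).
destruct (HA z Hz Nz) as (_ & _ & Nk). apply Cmod_gt_0 in Nk. rewrite Cmod_mult in L.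
apply (Rmult_le_compat_r (r * (Cmod z * Cmod (K z)))) in L.
- replace (Cmod (F z) / (Cmod z * Cmod (K z)) * (r * (Cmod z * Cmod (K z))))
    with (Cmod (F z) * r) in L by (field; lra).
  replace (1 / r * (r * (Cmod z * Cmod (K z)))) with (Cmod z * Cmod (K z)) in L by (field; lra). auto.
- repeat apply Rmult_le_pos; lra.
Qed.

(** By openness a value near [h w] is taken near [w], and injectivity identifies that preimage with
    the given [u]. *)
Lemma inverse_continuous (h : C -> C) :
  analytic_on_disc h ->
  (forall u v : C, unit_disc u -> unit_disc v -> h u = h v -> u = v) ->
  (forall z, unit_disc z -> C_derive h z <> 0) ->
  forall w eps, unit_disc w -> 0 < eps -> exists d, 0 < d /\
    forall u, unit_disc u -> Cmod (h u - h w) < d -> Cmod (u - w) < eps.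
Proof.
unfold unit_disc. intros HA HI HD w eps Hw He.
assert (In : forall u, Cmod (u - w) < 1 - Cmod w -> Cmod u < 1).
{ intros u Hu. replace u with (w + (u - w))%C by ring.
  eapply Rle_lt_trans; [apply Cmod_triangle|lra]. }
destruct (analytic_open_at h w (1 - Cmod w) (Rmin eps (1 - Cmod w))) as (d & Hd & H).
- lra.
- apply Rmin_pos; lra.
- intros z Hz. split; [apply HA|apply HD]; apply In; auto.
- exists d. split; auto. intros u Hu Hh. destruct (H _ Hh) as (v & Hv & E).
  rewrite <- (HI v u); auto.
  + exact (Rlt_le_trans _ _ _ Hv (Rmin_l _ _)).
  + apply In. exact (Rlt_le_trans _ _ _ Hv (Rmin_r _ _)).
Qed.

(** * Starlike functions *)

(* [fun z => h^-1 (t h z)] satisfies the hypotheses of the Schwarz lemma. Its analyticity is not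
   needed: near [c] it is compared with the linear map [z => k z], [k := W c / c], through the
   leading term of the analytic function [h (k z) - t h z]. *)
Lemma starlike_subordination (h : C -> C) (t : R) (W : C -> C) :
  analytic_on_disc h -> h 0%C = 0 ->
  (forall u v : C, unit_disc u -> unit_disc v -> h u = h v -> u = v) ->
  (forall z, unit_disc z -> C_derive h z <> 0) ->
  0 < t < 1 ->
  (forall z, unit_disc z -> unit_disc (W z) /\ h (W z) = (t * h z)%C) ->
  forall z, unit_disc z -> Cmod (W z) <= Cmod z.
Proof.
intros HA h0 HI HD Ht HW z Hz.
assert (Hc : forall c, unit_disc c -> continuous_at W c).
{ intros c Hc eps He. destruct (HW c Hc) as [Dc Ec].
  destruct (inverse_continuous h HA HI HD (W c) eps Dc He) as (d & Hd & K).
  destruct (analytic_at_continuous _ _ (HA c Hc) d Hd) as (d2 & Hd2 & K2).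
  unfold unit_disc in Hc.
  exists (Rmin d2 (1 - Cmod c)). split; [apply Rmin_pos; lra|]. intros x Hx.
  assert (Dx : unit_disc x).
  { unfold unit_disc. replace x with (c + (x - c))%C by ring.
    eapply Rle_lt_trans; [apply Cmod_triangle|].
    generalize (Rlt_le_trans _ _ _ Hx (Rmin_r _ _)). lra. }
  destruct (HW x Dx) as [Dx' Ex]. apply K; auto. rewrite Ex, Ec.
  replace (t * h x - t * h c)%C with (t * (h x - h c))%C by ring.
  rewrite Cmod_mult, Cmod_R, Rabs_pos_eq by lra.
  generalize (K2 x (Rlt_le_trans _ _ _ Hx (Rmin_l _ _))) (Cmod_ge_0 (h x - h c)). nra. }
assert (D0 : unit_disc 0) by (unfold unit_disc; rewrite Cmod_0; lra).
assert (W0 : W 0%C = 0).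
{ destruct (HW 0 D0) as [A B]. apply HI; auto. rewrite B, h0. ring. }
assert (Near0 : exists e, 0 < e /\ forall x, Cmod x < e -> Cmod (W x) <= Cmod x).
{ assert (P := proj1 (Cmod_gt_0 _) (HD 0 D0)). set (m := C_derive h 0%C) in *.
  (* Strict differentiability at 0 gives [(|m| - eps) |W x| <= t (|m| + eps) |x|]; this [eps] makes
     the two factors equal. *)
  set (eps := Cmod m * (1 - t) / (1 + t)).
  assert (Heps : 0 < eps) by (apply Rdiv_lt_0_compat; nra).
  assert (Eeps : eps * (1 + t) = Cmod m * (1 - t)) by (unfold eps; field; lra).
  destruct (analytic_at_strict_derive _ _ (HA 0 D0) eps Heps) as (d & Hd & S).
  fold m in S.
  destruct (Hc 0 D0 d Hd) as (d2 & Hd2 & K). rewrite W0 in K.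
  exists (Rmin (Rmin d d2) 1). split; [repeat apply Rmin_pos; lra|]. intros x Hx.
  assert (X1 := Rlt_le_trans _ _ _ Hx (Rle_trans _ _ _ (Rmin_l _ _) (Rmin_l _ _))).
  assert (X2 := Rlt_le_trans _ _ _ Hx (Rle_trans _ _ _ (Rmin_l _ _) (Rmin_r _ _))).
  assert (X3 := Rlt_le_trans _ _ _ Hx (Rmin_r _ _)).
  assert (Z : forall y : C, (y - 0)%C = y) by (intros; ring).
  assert (SW := S (W x) 0%C). assert (Sx := S x 0%C). specialize (K x).
  rewrite ?h0, ?Z, ?Cmod_0 in *. specialize (K X2). specialize (SW K Hd). specialize (Sx X1 Hd).
  rewrite (proj2 (HW x X3)) in SW.
  assert (T1 := Cmod_triangle (t * h x) (- (t * h x - m * W x))).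
  replace (t * h x + - (t * h x - m * W x))%C with (m * W x)%C in T1 by ring.
  assert (T2 := Cmod_triangle (h x - m * x) (m * x)).
  replace (h x - m * x + m * x)%C with (h x) in T2 by ring.
  rewrite Cmod_opp, !Cmod_mult, Cmod_R, Rabs_pos_eq in T1 by lra. rewrite Cmod_mult in T2.
  assert (T3 : t * Cmod (h x) <= t * ((eps + Cmod m) * Cmod x)) by (apply Rmult_le_compat_l; lra).
  apply (Rmult_le_reg_l (Cmod m - eps)); [nra|].
  replace (Cmod m - eps) with (t * (eps + Cmod m)) at 2 by lra. lra. }
destruct (Ceq_dec z 0) as [->|Nz]; [rewrite W0; lra|].
assert (Pz := proj1 (Cmod_gt_0 _) Nz). unfold unit_disc in *.
apply le_of_forall_radius with (Cmod z); auto using Cmod_ge_0.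
intros r [Hzr Hr1].
(* With the value 1, [Near0] gives upper semicontinuity at the origin, and since [1 < 1 / r] the
   origin is below the level at which local analysis is demanded. *)
set (q := fun z : C => if excluded_middle_informative (z = 0) then 1 else Cmod (W z) / Cmod z).
assert (q1 : forall x c : C, c <> 0 -> Cmod (x - c) < Cmod c -> q x = Cmod (W x) / Cmod x).
{ intros x c Nc Hx. unfold q. destruct excluded_middle_informative as [->|]; auto.
  replace (0 - c)%C with (- c)%C in Hx by ring. rewrite Cmod_opp in Hx. lra. }
assert (q1' : forall c : C, c <> 0 -> q c = Cmod (W c) / Cmod c).
{ intros c Nc. apply (q1 c c Nc). rewrite Cminus_diag, Cmod_0. apply Cmod_gt_0; auto. }
assert (q0 : q 0%C = 1) by (unfold q; destruct excluded_middle_informative; congruence).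
assert (Hr : 1 < 1 / r).
{ apply (Rmult_lt_reg_r r); [lra|]. replace (1 / r * r) with 1 by (field; lra). lra. }
assert (L : q z <= 1 / r).
{ apply (max_principle 0 r); [lra| | | |replace (z - 0)%C with z by ring; lra].
  - intros c Hcr. replace (c - 0)%C with c in Hcr by ring.
    destruct (Ceq_dec c 0) as [->|Nc].
    + destruct Near0 as (e & He & N). intros eps Heps. exists e. split; auto. intros x Hx.
      replace (x - 0)%C with x in Hx by ring. rewrite q0.
      destruct (Ceq_dec x 0) as [->|Nx]; [lra|]. rewrite q1' by auto.
      specialize (N x Hx). apply Cmod_gt_0 in Nx.
      apply (Rmult_lt_reg_r (Cmod x)); auto. unfold Rdiv. rewrite Rmult_assoc, Rinv_l by lra. nra.
    + apply (usc_at_ratio W (fun x => x)) with (Cmod c).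
      * apply Hc; lra.
      * apply continuous_at_id.
      * auto.
      * apply Cmod_gt_0; auto.
      * intros x Hx. apply q1 with c; auto.
  - intros c Hcr Hq. replace (c - 0)%C with c in Hcr by ring.
    destruct (Ceq_dec c 0) as [->|Nc]; [lra|].
    assert (Pc := proj1 (Cmod_gt_0 _) Nc).
    rewrite q1' in Hq by auto.
    destruct (HW c ltac:(lra)) as [DWc EWc].
    assert (NW : W c <> 0).
    { intros E. rewrite E, Cmod_0 in Hq. unfold Rdiv in Hq. lra. }
    set (k := (W c / c)%C).
    assert (Ek : Cmod k = Cmod (W c) / Cmod c) by (unfold k; apply Cmod_div; auto).
    assert (kc : (k * c)%C = W c) by (unfold k; field; auto).
    assert (Pk : 0 < Cmod k) by (rewrite Ek; apply Rdiv_lt_0_compat; auto; apply Cmod_gt_0; auto).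
    assert (AG := analytic_at_lin (- t) (fun x => h (k * x)%C) h c
      (analytic_at_scale k h c ltac:(rewrite kc; auto)) (HA c ltac:(unfold unit_disc; lra))).
    (* Within [d0] the point [c + x] stays in the disc and away from 0, and [k * (c + x)] stays in
       the disc. *)
    set (d0 := Rmin (Rmin (Cmod c) (1 - Cmod c)) ((1 - Cmod (W c)) / Cmod k)).
    assert (Hd0 : 0 < d0).
    { repeat apply Rmin_pos; try lra. apply Rdiv_lt_0_compat; lra. }
    assert (Hx0 : forall x, Cmod x < d0 ->
      Cmod x < Cmod c /\ Cmod (c + x) < 1 /\ Cmod (k * (c + x)) < 1).
    { intros x Hx.
      assert (X1 := Rlt_le_trans _ _ _ Hx (Rle_trans _ _ _ (Rmin_l _ _) (Rmin_l _ _))).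
      assert (X2 := Rlt_le_trans _ _ _ Hx (Rle_trans _ _ _ (Rmin_l _ _) (Rmin_r _ _))).
      assert (X3 := Rlt_le_trans _ _ _ Hx (Rmin_r _ _)).
      split; auto. split.
      - eapply Rle_lt_trans; [apply Cmod_triangle|lra].
      - rewrite Cmult_plus_distr_l, kc. eapply Rle_lt_trans; [apply Cmod_triangle|].
        rewrite Cmod_mult. apply (Rmult_lt_compat_l (Cmod k)) in X3; auto.
        replace (Cmod k * ((1 - Cmod (W c)) / Cmod k)) with (1 - Cmod (W c)) in X3 by (field; lra). lra. }
    clearbody d0.
    destruct (analytic_at_leading_term _ _ AG) as [(d & Hd & Z)|(n & g & d & Hd & Hg & Ng & Z)];
      cbv beta in Z.
    (* Here [h (k x) = t h x = h (W x)] near [c], so injectivity makes [W] the linear map itself and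
       the ratio is constant. *)
    + left. exists (Rmin d d0). split; [apply Rmin_pos; auto|]. intros x Hx.
      specialize (Z (x - c)%C (Rlt_le_trans _ _ _ Hx (Rmin_l _ _))).
      destruct (Hx0 (x - c)%C (Rlt_le_trans _ _ _ Hx (Rmin_r _ _))) as (X1 & X2 & X3).
      replace (c + (x - c))%C with x in Z, X2, X3 by ring.
      rewrite (q1 x c), (q1' c), <- Ek by auto.
      destruct (HW x X2) as [DWx EWx].
      assert (E : W x = (k * x)%C).
      { apply HI; auto. rewrite EWx.
        replace (h (k * x)%C) with (h (k * x)%C + - t * h x + t * h x)%C by ring. rewrite Z. ring. }
      rewrite E, Cmod_mult. field. intros Ex. apply Cmod_eq_0 in Ex. subst x.
      replace (0 - c)%C with (- c)%C in X1 by ring. rewrite Cmod_opp in X1. lra.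
    + right. assert (Hn : (0 < n)%nat).
      { destruct n; [|lia]. exfalso. specialize (Z 0 ltac:(rewrite Cmod_0; auto)).
        replace (c + 0)%C with c in Z by ring. apply Ng. simpl in Z.
        replace (g c) with (1 * g c)%C by ring. rewrite <- Z, kc, EWc. ring. }
      set (m := C_derive h (W c)). assert (Nm : m <> 0) by (apply HD; auto).
      assert (Pm := proj1 (Cmod_gt_0 _) Nm).
      (* [h (W (c + x)) - h (k (c + x))] is [- x^n g (c + x)] exactly and
         [m (W (c + x) - k (c + x))] to first order; hence this coefficient of the deviation of
         [W]. *)
      set (b := (- (g c / m))%C).
      assert (Nb : b <> 0).
      { apply Cmod_gt_0. unfold b. rewrite Cmod_opp, Cmod_div by auto.
        apply Rdiv_lt_0_compat; auto. apply Cmod_gt_0; auto. }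
      assert (Pb := proj1 (Cmod_gt_0 _) Nb).
      intros e He.
      destruct (modulus_increases W (fun x => x) c k b n) with (e := Rmin e d0) as (x & Hx & L); auto.
      * apply continuous_at_id.
      * apply Cmod_gt_0; auto.
      * intros eta Heta.
        (* The error [e1 |v|] is split along [v = (v - b x^n) + b x^n]: the first entry absorbs one
           part into the left side, the second gives the other half of the error budget. *)
        set (e1 := Rmin (Cmod m / 2) (eta * Cmod m / (4 * Cmod b))).
        assert (He1 : 0 < e1) by (apply Rmin_pos; apply Rdiv_lt_0_compat; nra).
        assert (e11 : e1 <= Cmod m / 2) by apply Rmin_l.
        assert (e12 : e1 * Cmod b <= eta * Cmod m / 4).
        { replace (eta * Cmod m / 4) with (eta * Cmod m / (4 * Cmod b) * Cmod b) by (field; lra).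
          apply Rmult_le_compat_r; [lra|apply Rmin_r]. }
        destruct (analytic_at_strict_derive _ _ (HA (W c) DWc) e1 He1) as (d1 & Hd1 & S1).
        fold m in S1.
        destruct (analytic_at_continuous _ _ Hg (eta * Cmod m / 4)) as (d2 & Hd2 & S2).
        { apply Rdiv_lt_0_compat; nra. }
        destruct (Hc c ltac:(lra) d1 Hd1) as (d3 & Hd3 & S3).
        set (d4 := d1 / Cmod k).
        assert (Hd4 : 0 < d4) by (apply Rdiv_lt_0_compat; auto).
        exists (Rmin (Rmin d d0) (Rmin d2 (Rmin d3 d4))). split; [repeat apply Rmin_pos; auto|].
        intros x Hx.
        assert (Y1 := Rlt_le_trans _ _ _ Hx (Rmin_l _ _)).
        assert (Y2 := Rlt_le_trans _ _ _ Hx (Rmin_r _ _)).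
        assert (Y3 := Rlt_le_trans _ _ _ Y2 (Rmin_r _ _)).
        destruct (Hx0 x (Rlt_le_trans _ _ _ Y1 (Rmin_r _ _))) as (X1 & X2 & X3).
        specialize (Z x (Rlt_le_trans _ _ _ Y1 (Rmin_l _ _))).
        specialize (S2 (c + x)%C). specialize (S3 (c + x)%C).
        replace (c + x - c)%C with x in S2, S3 by ring.
        specialize (S2 (Rlt_le_trans _ _ _ Y2 (Rmin_l _ _))).
        specialize (S3 (Rlt_le_trans _ _ _ Y3 (Rmin_l _ _))).
        assert (S4 := Rlt_le_trans _ _ _ Y3 (Rmin_r _ _)).
        specialize (S1 (W (c + x)%C) (k * (c + x))%C S3).
        replace (k * (c + x) - W c)%C with (k * x)%C in S1 by (rewrite <- kc; ring).
        rewrite (Cmod_mult k x) in S1.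
        apply (Rmult_lt_compat_l (Cmod k)) in S4; auto.
        replace (Cmod k * d4) with d1 in S4 by (unfold d4; field; lra).
        specialize (S1 S4). rewrite (proj2 (HW (c + x)%C X2)) in S1.
        set (v := (W (c + x)%C - k * (c + x))%C) in *.
        replace (t * h (c + x)%C - h (k * (c + x))%C - m * v)%C
          with (- (h (k * (c + x))%C + - t * h (c + x)%C) - m * v)%C in S1 by ring.
        rewrite Z in S1.
        assert (T1 := Cmod_triangle (v - b * x ^ n) (b * x ^ n)).
        replace (v - b * x ^ n + b * x ^ n)%C with v in T1 by ring.
        rewrite (Cmod_mult b), Cmod_pow in T1.
        assert (T2 := Cmod_triangle (- (- (x ^ n * g (c + x)%C) - m * v)) (- (x ^ n * (g (c + x)%C - g c)))).
        replace (- (- (x ^ n * g (c + x)%C) - m * v) + - (x ^ n * (g (c + x)%C - g c)))%C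
          with (m * (v - b * x ^ n))%C in T2 by (unfold b; field; auto).
        rewrite !Cmod_opp, !Cmod_mult, Cmod_pow in T2.
        assert (Xn := pow_le (Cmod x) n (Cmod_ge_0 x)).
        apply (Rmult_le_reg_l (Cmod m / 2)); [lra|].
        assert (U1 : Cmod x ^ n * Cmod (g (c + x)%C - g c) <= Cmod x ^ n * (eta * Cmod m / 4))
          by (apply Rmult_le_compat_l; lra).
        assert (U2 : e1 * Cmod v <= e1 * (Cmod (v - b * x ^ n) + Cmod b * Cmod x ^ n))
          by (apply Rmult_le_compat_l; lra).
        assert (U3 : e1 * Cmod (v - b * x ^ n) <= Cmod m / 2 * Cmod (v - b * x ^ n))
          by (apply Rmult_le_compat_r; auto; apply Cmod_ge_0).
        assert (U4 : e1 * Cmod b * Cmod x ^ n <= eta * Cmod m / 4 * Cmod x ^ n)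
          by (apply Rmult_le_compat_r; auto).
        lra.
      * apply Rmin_pos; auto.
      * exists (c + x)%C.
        destruct (Hx0 x (Rlt_le_trans _ _ _ Hx (Rmin_r _ _))) as (X1 & X2 & X3).
        assert (Ex : (c + x - c)%C = x) by ring.
        rewrite (q1 (c + x)%C c), q1', Ex, <- Ek by (auto; rewrite Ex; auto).
        split; [exact (Rlt_le_trans _ _ _ Hx (Rmin_l _ _))|].
        assert (Px : 0 < Cmod (c + x)).
        { assert (T := Cmod_triangle (c + x) (- x)). rewrite Cmod_opp in T.
          replace (c + x + - x)%C with c in T by ring. lra. }
        apply (Rmult_lt_reg_r (Cmod (c + x))); auto.
        unfold Rdiv. rewrite Rmult_assoc, Rinv_l by lra. lra.
  - intros c Hcr. replace (c - 0)%C with c in Hcr by ring.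
    assert (Nc : c <> 0) by (apply Cmod_gt_0; lra).
    rewrite q1', Hcr by auto.
    apply Rmult_le_compat_r; [left; apply Rinv_0_lt_compat; lra|].
    left. apply HW. lra. }
rewrite q1' in L by auto.
apply (Rmult_le_compat_r (Cmod z * r)) in L; [|nra].
replace (Cmod (W z) / Cmod z * (Cmod z * r)) with (Cmod (W z) * r) in L by (field; lra).
replace (1 / r * (Cmod z * r)) with (Cmod z) in L by (field; lra). auto.
Qed.

(** The quantity is [|h|^2 Re (z h' / h)], free of division. For [t = 1 - s] the displacement
    [v = W z - z] is about [- s h / h'], while [|z + v| <= |z|] forces [Re (conj z v) <= 0]. A
    single small [s] contradicts a negative value. *)
Lemma starlike_real_part (h : C -> C) :
  starlike_analytic h -> (forall z, unit_disc z -> C_derive h z <> 0) ->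
  forall z, unit_disc z -> 0 <= Re (Cconj (z * C_derive h z) * h z).
Proof.
intros (HA & HI & h0 & HS) HD z Hz.
set (m := C_derive h z). assert (Nm : m <> 0) by (apply HD; auto).
assert (Pm := proj1 (Cmod_gt_0 _) Nm).
set (X := Re (Cconj (z * m) * h z)).
assert (P := Cmod_ge_0 (h z)). assert (Pz := Cmod_ge_0 z).
apply Rnot_lt_le. intros L.
(* Scaled so that the linearisation error is at most [s * eps * M / 2], thus at most half of the
   first order term [- s * X]. *)
set (M := 4 * (1 + Cmod z) * (1 + Cmod (h z))).
assert (HM : 0 < M) by (unfold M; nra).
set (eps := Rmin (Cmod m / 2) (- X / M)).
assert (Heps : 0 < eps) by (apply Rmin_pos; [lra|apply Rdiv_lt_0_compat; lra]).
assert (eps1 : eps <= Cmod m / 2) by apply Rmin_l.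
assert (eps2 : eps * M <= - X).
{ replace (- X) with (- X / M * M) by (field; lra). apply Rmult_le_compat_r; [lra|apply Rmin_r]. }
destruct (analytic_at_strict_derive _ _ (HA z Hz) eps Heps) as (d & Hd & S). fold m in S.
destruct (inverse_continuous h HA HI HD z d Hz Hd) as (d2 & Hd2 & S2).
set (s := Rmin (/ 2) (d2 / (2 * (1 + Cmod (h z))))).
assert (Hs : 0 < s) by (apply Rmin_pos; [lra|apply Rdiv_lt_0_compat; lra]).
assert (s1 : s <= / 2) by apply Rmin_l.
assert (s2 : s * (1 + Cmod (h z)) <= d2 / 2).
{ replace (d2 / 2) with (d2 / (2 * (1 + Cmod (h z))) * (1 + Cmod (h z))) by (field; lra).
  apply Rmult_le_compat_r; [lra|apply Rmin_r]. }
assert (Ch : exists W : C -> C, forall x, unit_disc x -> unit_disc (W x) /\ h (W x) = (RtoC (1 - s) * h x)%C).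
{ apply (choice (fun x y => unit_disc x -> unit_disc y /\ h y = (RtoC (1 - s) * h x)%C)).
  intros x. destruct (classic (unit_disc x)) as [Dx|Dx].
  - destruct (HS x (1 - s) Dx ltac:(lra)) as (y & Hy). exists y. auto.
  - exists 0%C. contradiction. }
destruct Ch as (W & HW).
assert (Lw := starlike_subordination h (1 - s) W HA h0 HI HD ltac:(lra) HW z Hz).
destruct (HW z Hz) as [Dw Ew]. set (w := W z) in *.
assert (Dh : (h w - h z)%C = (- s * h z)%C) by (rewrite Ew, RtoC_minus; ring).
assert (Dhm : Cmod (- s * h z) = s * Cmod (h z)).
{ rewrite Cmod_mult, Cmod_opp, Cmod_R, Rabs_pos_eq; lra. }
assert (Nw : Cmod (w - z) < d).
{ apply S2; auto. rewrite Dh, Dhm. nra. }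
specialize (S w z Nw ltac:(rewrite Cminus_diag, Cmod_0; auto)). rewrite Dh in S.
set (v := (w - z)%C) in *.
assert (T1 := Cmod_triangle (- (- s * h z - m * v)) (- s * h z)).
replace (- (- s * h z - m * v) + - s * h z)%C with (m * v)%C in T1 by ring.
rewrite Cmod_opp, Cmod_mult, Dhm in T1.
assert (Pv := Cmod_ge_0 v).
assert (T2 : Cmod m * Cmod v <= 2 * s * Cmod (h z)) by nra.
assert (F := Cmod_plus_sqr z v).
replace (z + v)%C with w in F by (unfold v; ring).
assert (F1 : Cmod w ^ 2 <= Cmod z ^ 2) by (apply pow_incr; split; auto; apply Cmod_ge_0).
assert (F2 : Re (Cconj z * v) <= 0) by (generalize (pow2_ge_0 (Cmod v)); lra).
assert (E : Re (Cconj (z * m) * (m * v)) = Cmod m ^ 2 * Re (Cconj z * v)).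
{ replace (Cconj (z * m) * (m * v))%C with (RtoC (Cmod m ^ 2) * (Cconj z * v))%C.
  - rewrite re_scal_l. auto.
  - rewrite Cmod2_conj, Cmult_conj. ring. }
assert (E2 : Re (Cconj (z * m) * (m * v)) = - s * X + Re (Cconj (z * m) * - (- s * h z - m * v))).
{ unfold X. rewrite <- re_scal_l, <- re_plus. f_equal. rewrite RtoC_opp. ring. }
assert (B := re_le_Cmod (Cconj (z * m) * - (- s * h z - m * v))).
apply Rabs_le_between in B.
rewrite Cmod_mult, Cmod_opp, Cmod_conj, Cmod_mult in B.
assert (Q : Cmod z * Cmod m * Cmod (- s * h z - m * v) <= Cmod z * (eps * (2 * s * Cmod (h z)))).
{ rewrite Rmult_assoc. apply Rmult_le_compat_l; auto.
  apply Rle_trans with (Cmod m * (eps * Cmod v)); [apply Rmult_le_compat_l; lra|].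
  replace (Cmod m * (eps * Cmod v)) with (eps * (Cmod m * Cmod v)) by ring.
  apply Rmult_le_compat_l; lra. }
assert (Q2 : Cmod z * (eps * (2 * s * Cmod (h z))) <= s * (eps * (M / 2))).
{ replace (Cmod z * (eps * (2 * s * Cmod (h z)))) with (s * (eps * (2 * (Cmod z * Cmod (h z))))) by ring.
  apply Rmult_le_compat_l; [lra|]. apply Rmult_le_compat_l; [lra|]. unfold M. nra. }
assert (Q3 : s * (eps * (M / 2)) <= s * (- X / 2)) by (apply Rmult_le_compat_l; lra).
assert (Q4 : 0 <= Cmod m ^ 2) by apply pow2_ge_0.
nra.
Qed.

Lemma Cmod_plus_1_sqr (y v : C) :
  Cmod (y + 1 * v) ^ 2 = Cmod y ^ 2 + 2 * Re (Cconj y * v) + Cmod v ^ 2.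
Proof. rewrite Cmult_1_l. apply Cmod_plus_sqr. Qed.

Lemma Cmod_minus_1_sqr (y v : C) :
  Cmod (y + - (1) * v) ^ 2 = Cmod y ^ 2 - 2 * Re (Cconj y * v) + Cmod v ^ 2.
Proof. rewrite !Cmod2_alt. destruct y, v; simpl. ring. Qed.

Lemma le_of_pow2_le (a b : R) : 0 <= b -> a ^ 2 <= b ^ 2 -> a <= b.
Proof. intros Hb H. apply Rnot_lt_le. intros L. nra. Qed.

(** Both sides vanish at the origin: with [h = z h1], the right one is [z (h' + h1)] and the left
    one [z (h' - h1)], where [h' - h1] has a further zero. So the common factor [e] is [z]. The
    coefficients [1] and [- (1)] are written out to fit [analytic_at_lin]. *)
Lemma starlike_schwarz (h : C -> C) :
  starlike_analytic h -> (forall z, unit_disc z -> C_derive h z <> 0) ->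
  forall z, unit_disc z ->
    Cmod (z * C_derive h z + - (1) * h z) <= Cmod z * Cmod (z * C_derive h z + 1 * h z).
Proof.
intros SH HD z Hz.
assert (RP := starlike_real_part h SH HD).
destruct SH as (HA & HI & h0 & HS).
assert (D0 : unit_disc 0) by (unfold unit_disc; rewrite Cmod_0; lra).
destruct (analytic_at_factor h 0 (HA 0%C D0) h0) as (h1 & d1 & Hd1 & Ah1 & E1 & F1).
assert (Ad := analytic_at_derive _ _ (HA 0%C D0)).
destruct (analytic_at_factor (fun z => C_derive h z + - (1) * h1 z)%C 0) as (f & d2 & Hd2 & Af & _ & F2).
{ apply analytic_at_lin; auto. }
{ rewrite E1. ring. }
refine (schwarz_ratio (fun z => z * C_derive h z + - (1) * h z)%C
  (fun z => z * C_derive h z + 1 * h z)%C (fun z => z) f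
  (fun z => C_derive h z + 1 * h1 z)%C (Rmin d1 d2) _ _ _ _ _ _ _ z Hz).
- intros x Hx Nx. assert (A1 := analytic_at_mul_id _ _ (analytic_at_derive _ _ (HA x Hx))).
  split; [|split].
  + exact (analytic_at_lin (- (1)) _ _ _ A1 (HA x Hx)).
  + exact (analytic_at_lin 1 _ _ _ A1 (HA x Hx)).
  (* A zero means [h x = - x h' x], and the real part would be [- |x h' x|^2 < 0]. *)
  + intros E. specialize (RP x Hx).
    assert (N : (x * C_derive h x)%C <> 0) by (apply Cmult_neq_0; auto).
    apply Cmod_gt_0 in N.
    assert (Eh : h x = (- (x * C_derive h x))%C).
    { replace (h x) with (x * C_derive h x + 1 * h x - x * C_derive h x)%C by ring.
      rewrite E. ring. }
    rewrite Eh in RP. set (P := (x * C_derive h x)%C) in *.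
    replace (Cconj P * - P)%C with (- (P * Cconj P))%C in RP by ring.
    rewrite <- Cmod2_conj, re_opp, re_RtoC in RP. nra.
- intros x Hx. apply le_of_pow2_le; [apply Cmod_ge_0|].
  rewrite Cmod_plus_1_sqr, Cmod_minus_1_sqr. generalize (RP x Hx). lra.
- exact Af.
- apply analytic_at_lin; auto.
- rewrite E1. replace (C_derive h 0 + 1 * C_derive h 0)%C with (2 * C_derive h 0%C)%C by ring.
  apply Cmult_neq_0; auto. intros E. apply RtoC_inj in E. lra.
- apply Rmin_pos; auto.
- intros x Hx.
  specialize (F1 x (Rlt_le_trans _ _ _ Hx (Rmin_l _ _))).
  specialize (F2 x (Rlt_le_trans _ _ _ Hx (Rmin_r _ _))).
  rewrite Cplus_0_l in F1, F2. cbv beta in F2. rewrite F1. split.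
  + replace (x * C_derive h x + - (1) * (x * h1 x))%C
      with (x * (C_derive h x + - (1) * h1 x))%C by ring.
    rewrite F2. ring.
  + ring.
Qed.

(** The hypothesis factors as [((1 - r) a - (1 + r) b) ((1 + r) a - (1 - r) b) <= 0], which confines
    [a / b] between the two roots. *)
Lemma quadratic_range (r a b : R) :
  0 <= r < 1 -> 0 < b -> (1 - r ^ 2) * (a ^ 2 + b ^ 2) <= 2 * (1 + r ^ 2) * (a * b) ->
  (1 - r) * b <= (1 + r) * a /\ (1 - r) * a <= (1 + r) * b.
Proof.
intros Hr Hb H.
assert (F : ((1 - r) * a - (1 + r) * b) * ((1 + r) * a - (1 - r) * b) <= 0) by nra.
split; apply Rnot_lt_le; intros L.
- assert ((1 - r) * a - (1 + r) * b < 0).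
  { assert (a < b) by nra. nra. }
  nra.
- assert (0 < (1 + r) * a - (1 - r) * b).
  { assert (b < a) by nra. nra. }
  nra.
Qed.

(** The same interval holds for the real part and for the modulus of [z h' / h]; the former drives
    the growth estimate, the latter turns growth into distortion. *)
Lemma starlike_log_derivative (h : C -> C) :
  starlike_analytic h -> (forall z, unit_disc z -> C_derive h z <> 0) ->
  forall z, unit_disc z -> z <> 0 ->
    let r := Cmod z in let P := (z * C_derive h z)%C in
    0 < Cmod (h z) /\
    ((1 - r) * Cmod (h z) ^ 2 <= (1 + r) * Re (Cconj P * h z) /\
     (1 - r) * Re (Cconj P * h z) <= (1 + r) * Cmod (h z) ^ 2) /\
    ((1 - r) * Cmod (h z) <= (1 + r) * Cmod P /\
     (1 - r) * Cmod P <= (1 + r) * Cmod (h z)).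
Proof.
intros SH HD z Hz Nz r P.
assert (Sw := starlike_schwarz h SH HD z Hz). fold P r in Sw.
destruct SH as (HA & HI & h0 & HS).
assert (Hr : 0 <= r < 1) by (split; [apply Cmod_ge_0|exact Hz]).
assert (Nh : 0 < Cmod (h z)).
{ apply Cmod_gt_0. intros E. apply Nz. apply HI; auto.
  - unfold unit_disc. rewrite Cmod_0. lra.
  - rewrite E, h0. auto. }
set (X := Re (Cconj P * h z)).
assert (S2 : Cmod (P + - (1) * h z) ^ 2 <= r ^ 2 * Cmod (P + 1 * h z) ^ 2).
{ rewrite <- Rpow_mult_distr. apply pow_incr. split; [apply Cmod_ge_0|auto]. }
rewrite Cmod_plus_1_sqr, Cmod_minus_1_sqr in S2. fold X in S2.
assert (XB := re_le_Cmod (Cconj P * h z)). fold X in XB.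
rewrite Cmod_mult, Cmod_conj in XB. apply Rabs_le_between in XB.
assert (PP := Cmod_ge_0 P).
assert (X2 : X ^ 2 <= Cmod P ^ 2 * Cmod (h z) ^ 2).
{ rewrite <- Rpow_mult_distr. nra. }
assert (r2 : r ^ 2 < 1) by nra. assert (r20 : 0 <= r ^ 2) by nra.
split; auto. split; apply quadratic_range; auto.
- apply pow_lt; auto.
(* Multiply the disc condition by [|h|^2] and replace [|P|^2 |h|^2] by the smaller [X^2], the part
   of the disc seen on the real axis. *)
- set (u := Cmod (h z) ^ 2) in *. set (p := Cmod P ^ 2) in *.
  assert (0 < u) by (apply pow_lt; auto).
  assert ((1 - r ^ 2) * X ^ 2 <= (1 - r ^ 2) * (p * u)) by (apply Rmult_le_compat_l; lra).
  assert ((1 - r ^ 2) * (p + u) * u <= 2 * (1 + r ^ 2) * X * u) by (apply Rmult_le_compat_r; lra).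
  nra.
- nra.
Qed.

(** * Growth along rays, distortion, and bounds for the dilatation *)

Lemma derivable_pt_lim_of_quadratic_bound (f : R -> R) (x l B d : R) :
  0 < d -> 0 <= B ->
  (forall t, Rabs t < d -> Rabs (f (x + t) - f x - t * l) <= B * t ^ 2) ->
  derivable_pt_lim f x l.
Proof.
intros Hd HB H eps He.
assert (Hd2 : 0 < Rmin d (eps / (B + 1))).
{ apply Rmin_pos; auto. apply Rdiv_lt_0_compat; lra. }
exists (mkposreal _ Hd2). simpl. intros t Nt Ht.
assert (T1 := Rlt_le_trans _ _ _ Ht (Rmin_l _ _)).
assert (T2 := Rlt_le_trans _ _ _ Ht (Rmin_r _ _)).
assert (Pt := Rabs_pos_lt t Nt).
apply (Rmult_lt_compat_r (B + 1)) in T2; [|lra].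
replace (eps / (B + 1) * (B + 1)) with eps in T2 by (field; lra).
replace ((f (x + t) - f x) / t - l) with ((f (x + t) - f x - t * l) / t) by (field; auto).
unfold Rdiv. rewrite Rabs_mult, Rabs_inv.
apply (Rmult_lt_reg_r (Rabs t)); auto. rewrite Rmult_assoc, Rinv_l by lra.
specialize (H t T1). rewrite <- (pow2_abs t) in H. nra.
Qed.

(** The squared modulus is differentiated, rather than [log |h|], so that Taylor's estimate for [h]
    carries over by expanding a square. *)
Lemma derivable_pt_lim_sqr_Cmod_ray (h : C -> C) (e : C) (s : R) :
  Cmod e = 1 -> analytic_at h (s * e)%C ->
  derivable_pt_lim (fun s => Cmod (h (s * e)%C) ^ 2) s
    (2 * Re (Cconj (e * C_derive h (s * e)%C) * h (s * e)%C)).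
Proof.
intros He A. destruct (analytic_at_taylor1_center _ _ A) as (B & d & HB & Hd & T).
set (c := (s * e)%C) in *. set (m := C_derive h c) in *.
assert (Pm := Cmod_ge_0 m). assert (Ph := Cmod_ge_0 (h c)).
apply derivable_pt_lim_of_quadratic_bound with (2 * Cmod (h c) * B + (Cmod m + B) ^ 2) (Rmin d 1).
- apply Rmin_pos; lra.
- nra.
- intros t Ht.
  assert (T1 := Rlt_le_trans _ _ _ Ht (Rmin_l _ _)).
  assert (T2 := Rlt_le_trans _ _ _ Ht (Rmin_r _ _)).
  specialize (T (t * e)%C). rewrite Cmod_mult, He, Cmod_R, Rmult_1_r in T. specialize (T T1).
  replace (RtoC (s + t) * e)%C with (c + t * e)%C by (unfold c; rewrite RtoC_plus; ring).
  set (E := (h (c + t * e)%C - h c - t * e * m)%C) in *.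
  set (v := (t * (e * m) + E)%C).
  assert (Hv : h (c + t * e)%C = (h c + v)%C) by (unfold v, E; ring).
  fold c. rewrite Hv, Cmod_plus_sqr.
  assert (R1 : Re (Cconj (h c) * v) = t * Re (Cconj (e * m) * h c) + Re (Cconj (h c) * E)).
  { replace (Re (Cconj (e * m) * h c)) with (Re (Cconj (h c) * (e * m))).
    - unfold v. rewrite <- re_scal_l, <- re_plus. f_equal. ring.
    - rewrite <- re_conj, Cmult_conj, Cconj_conj. f_equal. ring. }
  rewrite R1.
  assert (R2 := re_le_Cmod (Cconj (h c) * E)). rewrite Cmod_mult, Cmod_conj in R2.
  assert (V : Cmod v <= Rabs t * (Cmod m + B)).
  { unfold v. eapply Rle_trans; [apply Cmod_triangle|].
    rewrite !Cmod_mult, He, Cmod_R.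
    assert (Rabs t ^ 2 <= Rabs t) by (generalize (Rabs_pos t); nra).
    assert (B * Rabs t ^ 2 <= B * Rabs t) by (apply Rmult_le_compat_l; auto).
    lra. }
  assert (V2 : Cmod v ^ 2 <= t ^ 2 * (Cmod m + B) ^ 2).
  { rewrite <- (pow2_abs t), <- Rpow_mult_distr. apply pow_incr. split; auto. apply Cmod_ge_0. }
  rewrite pow2_abs in T.
  assert (R3 : Cmod (h c) * Cmod E <= Cmod (h c) * (B * t ^ 2)) by (apply Rmult_le_compat_l; auto).
  apply Rabs_le_between in R2. apply Rabs_le_between.
  assert (V3 := pow2_ge_0 (Cmod v)).
  set (vv := Cmod v ^ 2) in *. set (xx := Re (Cconj (e * m) * h c)) in *.
  set (ee := Re (Cconj (h c) * E)) in *. set (tt := t ^ 2) in *. split; lra.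
Qed.

Lemma le_of_le_plus_small (a b B d : R) :
  0 < d -> 0 <= B -> (forall s, 0 < s < d -> a <= b + B * s) -> a <= b.
Proof.
intros Hd HB H. apply Rnot_lt_le. intros L.
set (s := Rmin (d / 2) ((a - b) / (2 * (B + 1)))).
assert (Hs : 0 < s) by (apply Rmin_pos; [lra|apply Rdiv_lt_0_compat; lra]).
assert (s1 : s <= d / 2) by apply Rmin_l.
assert (s2 : s * (2 * (B + 1)) <= a - b).
{ replace (a - b) with ((a - b) / (2 * (B + 1)) * (2 * (B + 1))) by (field; lra).
  apply Rmult_le_compat_r; [lra|apply Rmin_r]. }
specialize (H s ltac:(lra)). nra.
Qed.

(* [|h(s e)|^2 (1 - s)^4 / s^2] is nonincreasing in [s], [|h(s e)|^2 (1 + s)^4 / s^2] is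
   nondecreasing, and both tend to [1] at [0]. *)
Lemma starlike_growth (h : C -> C) :
  starlike_analytic h -> (forall z, unit_disc z -> C_derive h z <> 0) -> C_derive h 0%C = 1 ->
  forall z, unit_disc z -> z <> 0 ->
    Cmod (h z) * (1 - Cmod z) ^ 2 <= Cmod z /\ Cmod z <= Cmod (h z) * (1 + Cmod z) ^ 2.
Proof.
intros SH HD h1 z Hz Nz.
assert (LD := starlike_log_derivative h SH HD).
destruct SH as (HA & HI & h0 & HS).
assert (Pz := proj1 (Cmod_gt_0 _) Nz). unfold unit_disc in Hz.
set (r := Cmod z) in *.
assert (Nr : RtoC r <> 0) by (intros E; apply RtoC_inj in E; lra).
set (e := (z / r)%C).
assert (He : Cmod e = 1).
{ unfold e. rewrite Cmod_div, Cmod_R, Rabs_pos_eq by (auto; lra). fold r. field. lra. }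
assert (Ez : (r * e)%C = z) by (unfold e; field; auto).
assert (Ms : forall s : R, 0 <= s -> Cmod (s * e) = s).
{ intros s Hs. rewrite Cmod_mult, He, Cmod_R, Rabs_pos_eq; lra. }
assert (Ds : forall s : R, 0 <= s < 1 -> unit_disc (s * e)).
{ intros s Hs. unfold unit_disc. rewrite Ms; lra. }
set (u := fun s : R => Cmod (h (s * e)%C) ^ 2).
set (X := fun s : R => Re (Cconj (s * e * C_derive h (s * e)%C) * h (s * e)%C)).
assert (DU : forall s, 0 < s < 1 -> derivable_pt_lim u s (2 * X s / s)).
{ intros s Hs. replace (2 * X s / s) with (2 * Re (Cconj (e * C_derive h (s * e)%C) * h (s * e)%C)).
  - apply derivable_pt_lim_sqr_Cmod_ray; auto. apply HA, Ds. lra.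
  - unfold X. replace (Cconj (s * e * C_derive h (s * e)%C) * h (s * e)%C)%C
      with (s * (Cconj (e * C_derive h (s * e)%C) * h (s * e)%C))%C.
    + rewrite re_scal_l. field. lra.
    + rewrite !Cmult_conj. replace (Cconj s) with (RtoC s); [ring|].
      unfold Cconj, RtoC; simpl. f_equal. ring. }
assert (XB : forall s, 0 < s < 1 ->
  (1 - s) * u s <= (1 + s) * X s /\ (1 - s) * X s <= (1 + s) * u s).
{ intros s Hs. assert (N : (s * e)%C <> 0) by (apply Cmod_gt_0; rewrite Ms; lra).
  destruct (LD (s * e)%C (Ds s ltac:(lra)) N) as (_ & K & _). rewrite Ms in K by lra. exact K. }
(* [k = -1] and [k = 1] serve the upper and the lower bound; the sign of
   [X c * (1 + k * c) - u c * (1 - k * c)] is then one half of [XB]. *)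
assert (Mono : forall k s, 0 < s < r ->
  exists c, 0 < c < 1 /\
    u r * (1 + k * r) ^ 4 / r ^ 2 - u s * (1 + k * s) ^ 4 / s ^ 2
    = 2 * (1 + k * c) ^ 3 / c ^ 3 * (X c * (1 + k * c) - u c * (1 - k * c)) * (r - s)).
{ intros k s Hs.
  destruct (MVT_cor2 (fun s => u s * (1 + k * s) ^ 4 / s ^ 2)
    (fun c => 2 * (1 + k * c) ^ 3 / c ^ 3 * (X c * (1 + k * c) - u c * (1 - k * c))) s r) as (c & Ec & Hc).
  - lra.
  - intros c Hc. apply is_derive_Reals.
    assert (U := proj2 (is_derive_Reals _ _ _) (DU c ltac:(lra))).
    auto_derive.
    + split; [eexists; exact U|]. split; [|exact I]. apply Rmult_integral_contrapositive_currified; lra.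
    + change (Derive (fun s => u s) c) with (Derive u c).
      rewrite (is_derive_unique _ _ _ U). simpl. field. lra.
  - exists c. split; [lra|]. exact Ec. }
destruct (analytic_at_taylor1_center h 0) as (B & d & HB & Hd & T).
{ apply HA. unfold unit_disc. rewrite Cmod_0. lra. }
rewrite h0, h1 in T.
assert (T' : forall s, 0 < s < d -> s * (1 - B * s) <= Cmod (h (s * e)%C) <= s * (1 + B * s)).
{ intros s Hs. specialize (T (s * e)%C). rewrite Ms in T by lra. specialize (T ltac:(lra)).
  replace (0 + s * e)%C with (s * e)%C in T by ring.
  replace (h (s * e)%C - 0 - s * e * 1)%C with (h (s * e)%C - s * e)%C in T by ring.
  assert (A1 := Cmod_triangle (h (s * e)%C - s * e) (s * e)).
  replace (h (s * e)%C - s * e + s * e)%C with (h (s * e)%C) in A1 by ring.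
  assert (A2 := Cmod_triangle (h (s * e)%C) (- (h (s * e)%C - s * e))).
  replace (h (s * e)%C + - (h (s * e)%C - s * e))%C with (s * e)%C in A2 by ring.
  rewrite Cmod_opp in A2. rewrite Ms in A1, A2 by lra. nra. }
(* Monotonicity is known for the square, but the limit at 0 is compared on the root, where [T'] is
   linear in [s]. *)
assert (HU : forall k s, 0 < s -> u s * (1 + k * s) ^ 4 / s ^ 2 = (Cmod (h (s * e)%C) * (1 + k * s) ^ 2 / s) ^ 2).
{ intros k s Hs. unfold u. field. lra. }
assert (Y0 : forall k s, 0 < s -> 0 <= Cmod (h (s * e)%C) * (1 + k * s) ^ 2 / s).
{ intros k s Hs. apply Rdiv_le_0_compat; auto. apply Rmult_le_pos; [apply Cmod_ge_0|apply pow2_ge_0]. }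
assert (Pc : forall k c, 0 < c -> 0 < 1 + k * c -> 0 < 2 * (1 + k * c) ^ 3 / c ^ 3).
{ intros k c Hc Hk. apply Rdiv_lt_0_compat; [apply Rmult_lt_0_compat; [lra|]|]; apply pow_lt; lra. }
assert (Dm : 0 < Rmin d r) by (apply Rmin_pos; lra).
split.
- assert (L : Cmod (h (r * e)%C) * (1 + -1 * r) ^ 2 / r <= 1).
  { apply le_of_le_plus_small with B (Rmin d r); auto.
    intros s [Hs0 Hs1].
    assert (Hs2 := Rlt_le_trans _ _ _ Hs1 (Rmin_l _ _)).
    assert (Hs3 := Rlt_le_trans _ _ _ Hs1 (Rmin_r _ _)).
    apply Rle_trans with (Cmod (h (s * e)%C) * (1 + -1 * s) ^ 2 / s).
    - apply le_of_pow2_le; [apply Y0; auto|]. rewrite <- !HU by lra.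
      destruct (Mono (-1) s ltac:(lra)) as (c & Hc & E).
      assert (Q := Pc (-1) c ltac:(lra) ltac:(lra)). destruct (XB c Hc) as [_ K].
      set (q := 2 * (1 + -1 * c) ^ 3 / c ^ 3) in *.
      assert (q * (X c * (1 + -1 * c) - u c * (1 - -1 * c)) * (r - s) <= 0).
      { assert (q * (X c * (1 + -1 * c) - u c * (1 - -1 * c)) <= 0) by nra. nra. }
      lra.
    - destruct (T' s ltac:(lra)) as [_ K].
      apply (Rmult_le_reg_r s); auto. unfold Rdiv. rewrite Rmult_assoc, Rinv_l, Rmult_1_r by lra.
      assert (0 <= (1 + -1 * s) ^ 2 <= 1) by nra.
      generalize (Cmod_ge_0 (h (s * e)%C)). nra. }
  rewrite Ez in L. apply (Rmult_le_compat_r r) in L; [|lra].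
  unfold Rdiv in L. rewrite Rmult_assoc, Rinv_l, Rmult_1_r, Rmult_1_l in L by lra.
  replace (1 - r) with (1 + -1 * r) by ring. exact L.
- assert (L : 1 <= Cmod (h (r * e)%C) * (1 + 1 * r) ^ 2 / r).
  { apply le_of_le_plus_small with B (Rmin d r); auto.
    intros s [Hs0 Hs1].
    assert (Hs2 := Rlt_le_trans _ _ _ Hs1 (Rmin_l _ _)).
    assert (Hs3 := Rlt_le_trans _ _ _ Hs1 (Rmin_r _ _)).
    assert (M : Cmod (h (s * e)%C) * (1 + 1 * s) ^ 2 / s <= Cmod (h (r * e)%C) * (1 + 1 * r) ^ 2 / r).
    { apply le_of_pow2_le; [apply Y0; auto|]. rewrite <- !HU by lra.
      destruct (Mono 1 s ltac:(lra)) as (c & Hc & E).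
      assert (Q := Pc 1 c ltac:(lra) ltac:(lra)). destruct (XB c Hc) as [K _].
      set (q := 2 * (1 + 1 * c) ^ 3 / c ^ 3) in *.
      assert (0 <= q * (X c * (1 + 1 * c) - u c * (1 - 1 * c)) * (r - s)).
      { assert (0 <= q * (X c * (1 + 1 * c) - u c * (1 - 1 * c))) by nra. nra. }
      lra. }
    assert (M2 : 1 - B * s <= Cmod (h (s * e)%C) * (1 + 1 * s) ^ 2 / s).
    { destruct (T' s ltac:(lra)) as [K _].
      apply (Rmult_le_reg_r s); auto. unfold Rdiv. rewrite Rmult_assoc, Rinv_l, Rmult_1_r by lra.
      assert (1 <= (1 + 1 * s) ^ 2) by nra.
      generalize (Cmod_ge_0 (h (s * e)%C)). nra. }
    lra. }
  rewrite Ez in L. apply (Rmult_le_compat_r r) in L; [|lra].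
  unfold Rdiv in L. rewrite Rmult_assoc, Rinv_l, Rmult_1_r, !Rmult_1_l in L by lra. exact L.
Qed.

(** Multiply the bounds for [|z h' / h|] and for [|h|], then cancel [|z|]; the origin is covered by
    [h' 0 = 1]. *)
Lemma starlike_distortion (h : C -> C) :
  starlike_analytic h -> (forall z, unit_disc z -> C_derive h z <> 0) -> C_derive h 0%C = 1 ->
  forall z, unit_disc z ->
    1 - Cmod z <= Cmod (C_derive h z) * (1 + Cmod z) ^ 3 /\
    Cmod (C_derive h z) * (1 - Cmod z) ^ 3 <= 1 + Cmod z.
Proof.
intros SH HD h1 z Hz.
destruct (Ceq_dec z 0) as [->|Nz]; [rewrite h1, Cmod_1, Cmod_0; lra|].
destruct (starlike_growth h SH HD h1 z Hz Nz) as [G1 G2].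
destruct (starlike_log_derivative h SH HD z Hz Nz) as (_ & _ & K1 & K2).
rewrite Cmod_mult in K1, K2.
assert (P := proj1 (Cmod_gt_0 _) Nz). unfold unit_disc in Hz.
set (r := Cmod z) in *. set (m := Cmod (C_derive h z)) in *. set (y := Cmod (h z)) in *.
split; apply (Rmult_le_reg_l r); auto.
- apply Rle_trans with ((1 - r) * (y * (1 + r) ^ 2)).
  + rewrite (Rmult_comm r (1 - r)). apply Rmult_le_compat_l; lra.
  + replace (r * (m * (1 + r) ^ 3)) with ((1 + r) * (r * m) * (1 + r) ^ 2) by ring.
    rewrite <- (Rmult_assoc _ y). apply Rmult_le_compat_r; auto. apply pow2_ge_0.
- apply Rle_trans with ((1 + r) * (y * (1 - r) ^ 2)).
  + replace (r * (m * (1 - r) ^ 3)) with ((1 - r) * (r * m) * (1 - r) ^ 2) by ring.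
    rewrite <- (Rmult_assoc _ y). apply Rmult_le_compat_r; auto. apply pow2_ge_0.
  + rewrite (Rmult_comm r (1 + r)). apply Rmult_le_compat_l; lra.
Qed.

(** With [w = y / x] this is the homogeneous form of [|1 - conj a w|^2 - |w - a|^2 = (1 - |a|^2) (1
    - |w|^2)], the identity behind disc automorphisms. *)
Lemma Cmod_dilatation_identity (a x y : C) :
  Cmod (x + - Cconj a * y) ^ 2 - Cmod (y + - a * x) ^ 2
  = (1 - Cmod a ^ 2) * (Cmod x ^ 2 - Cmod y ^ 2).
Proof. rewrite !Cmod2_alt. destruct a, x, y; simpl. ring. Qed.

(* Schwarz-Pick for the dilatation [g' / h']. *)
Lemma dilatation_bounds (h g : C -> C) (alpha : R) :
  analytic_on_disc h -> analytic_on_disc g ->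
  (forall z, unit_disc z -> Cmod (C_derive g z) < Cmod (C_derive h z)) ->
  C_derive h 0%C = 1 -> Cmod (C_derive g 0%C) = alpha -> alpha < 1 ->
  forall z, unit_disc z ->
    (alpha - Cmod z) * Cmod (C_derive h z) <= Cmod (C_derive g z) * (1 - alpha * Cmod z) /\
    Cmod (C_derive g z) * (1 + alpha * Cmod z) <= (alpha + Cmod z) * Cmod (C_derive h z).
Proof.
intros Hh Hg J h1 g1 Ha z Hz.
set (a := C_derive g 0%C) in *.
assert (A0 : 0 <= alpha) by (rewrite <- g1; apply Cmod_ge_0).
assert (D0 : unit_disc 0) by (unfold unit_disc; rewrite Cmod_0; lra).
assert (AF : forall x, unit_disc x -> analytic_at (fun z => C_derive g z + - a * C_derive h z)%C x).
{ intros x Hx. apply analytic_at_lin; apply analytic_at_derive; auto. }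
assert (AK : forall x, unit_disc x -> analytic_at (fun z => C_derive h z + - Cconj a * C_derive g z)%C x).
{ intros x Hx. apply analytic_at_lin; apply analytic_at_derive; auto. }
assert (NK : forall x, unit_disc x -> (C_derive h x + - Cconj a * C_derive g x)%C <> 0).
{ intros x Hx E. specialize (J x Hx).
  assert (T := Cmod_triangle (C_derive h x + - Cconj a * C_derive g x) (Cconj a * C_derive g x)).
  replace (C_derive h x + - Cconj a * C_derive g x + Cconj a * C_derive g x)%C
    with (C_derive h x) in T by ring.
  rewrite E, Cmod_0, Cmod_mult, Cmod_conj, g1 in T. generalize (Cmod_ge_0 (C_derive g x)). nra. }
destruct (analytic_at_factor _ _ (AF 0%C D0)) as (F1 & d & Hd & AF1 & _ & E1).
{ rewrite h1. fold a. ring. }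
assert (S : Cmod (C_derive g z + - a * C_derive h z)
  <= Cmod z * Cmod (C_derive h z + - Cconj a * C_derive g z)).
(* The denominator does not vanish at the origin, so the common factor [e] is constantly 1. *)
{ refine (schwarz_ratio (fun z => C_derive g z + - a * C_derive h z)%C
    (fun z => C_derive h z + - Cconj a * C_derive g z)%C (fun _ => RtoC 1) F1
    (fun z => C_derive h z + - Cconj a * C_derive g z)%C d _ _ _ _ _ Hd _ z Hz); auto.
  - intros x Hx. apply le_of_pow2_le; [apply Cmod_ge_0|].
    assert (I := Cmod_dilatation_identity a (C_derive h x) (C_derive g x)). rewrite g1 in I.
    assert (0 <= (1 - alpha ^ 2) * (Cmod (C_derive h x) ^ 2 - Cmod (C_derive g x) ^ 2)).
    { generalize (J x Hx) (Cmod_ge_0 (C_derive g x)). intros. apply Rmult_le_pos; nra. }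
    lra.
  - intros x Hx. specialize (E1 x Hx). rewrite Cplus_0_l in E1. rewrite E1. split; ring. }
assert (S2 : Cmod (C_derive g z + - a * C_derive h z) ^ 2
  <= Cmod z ^ 2 * Cmod (C_derive h z + - Cconj a * C_derive g z) ^ 2).
{ rewrite <- Rpow_mult_distr. apply pow_incr. split; [apply Cmod_ge_0|auto]. }
assert (I := Cmod_dilatation_identity a (C_derive h z) (C_derive g z)).
specialize (J z Hz). rewrite g1 in I.
assert (E := Cmod_plus_sqr (C_derive g z) (- a * C_derive h z)).
assert (RB := re_le_Cmod (Cconj (C_derive g z) * (- a * C_derive h z))).
rewrite !Cmod_mult, Cmod_conj, Cmod_opp, g1 in RB. apply Rabs_le_between in RB.
rewrite Cmod_mult, Cmod_opp, g1 in E.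
unfold unit_disc in Hz. assert (Pz := Cmod_ge_0 z). assert (PG := Cmod_ge_0 (C_derive g z)).
set (r := Cmod z) in *. set (G := Cmod (C_derive g z)) in *. set (H := Cmod (C_derive h z)) in *.
set (X := Re _) in *. set (U := Cmod (C_derive g z + _) ^ 2) in *. set (V := Cmod (C_derive h z + _) ^ 2) in *.
assert (PHG : 0 <= H - alpha * G) by nra.
(* Passes to moduli: [U >= (G - alpha H)^2] by the triangle inequality, and [V - U] equals
   [(H - alpha G)^2 - (G - alpha H)^2], both being [(1 - alpha^2) (H^2 - G^2)]. The two signs of the
   root yield the two bounds. *)
assert (Q : (G - alpha * H) ^ 2 <= (r * (H - alpha * G)) ^ 2).
{ assert (r2 : 0 <= 1 - r ^ 2) by nra.
  assert (U1 : (1 - r ^ 2) * (G - alpha * H) ^ 2 <= (1 - r ^ 2) * U) by (apply Rmult_le_compat_l; nra).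
  nra. }
assert (Pq : 0 <= r * (H - alpha * G)) by (apply Rmult_le_pos; auto).
assert (Q1 := le_of_pow2_le _ _ Pq Q).
replace ((G - alpha * H) ^ 2) with ((alpha * H - G) ^ 2) in Q by ring.
assert (Q2 := le_of_pow2_le _ _ Pq Q).
split; lra.
Qed.

Theorem theorem2p4 (alpha : R) (Halpha : 0 <= alpha < 1)
    (f h g : C -> C) (Hf : in_LH_starlike alpha f h g)
    (z : C) (Hz : unit_disc z) :
  (if Rlt_dec (Cmod z) alpha
   then (alpha - Cmod z) * (1 - Cmod z)
        / ((1 - alpha * Cmod z) * (1 + Cmod z) ^ 3)
   else 0)
  <= Cmod (C_derive g z)
  /\
  Cmod (C_derive g z)
  <= (alpha + Cmod z) * (1 + Cmod z)
     / ((1 + alpha * Cmod z) * (1 - Cmod z) ^ 3).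
Proof.
destruct Hf as ((_ & (Hh & Hg & _ & _) & _ & J & _ & h1) & g1 & SH).
(* The positive Jacobian serves twice: it keeps the dilatation inside the disc and makes [h']
   nonzero. *)
assert (J' : forall x, unit_disc x -> Cmod (C_derive g x) < Cmod (C_derive h x)).
{ intros x Hx. specialize (J x Hx). unfold jacobian in J.
  generalize (Cmod_ge_0 (C_derive g x)) (Cmod_ge_0 (C_derive h x)). intros.
  apply Rnot_le_lt. intros L. nra. }
assert (HD : forall x, unit_disc x -> C_derive h x <> 0).
{ intros x Hx. apply Cmod_gt_0. generalize (J' x Hx) (Cmod_ge_0 (C_derive g x)). lra. }
destruct (starlike_distortion h SH HD h1 z Hz) as [D1 D2].
destruct (dilatation_bounds h g alpha Hh Hg J' h1 g1 (proj2 Halpha) z Hz) as [W1 W2].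
unfold unit_disc in Hz. assert (Pz := Cmod_ge_0 z).
set (r := Cmod z) in *. set (G := Cmod (C_derive g z)) in *. set (H := Cmod (C_derive h z)) in *.
assert (P1 : 0 < (1 + r) ^ 3) by (apply pow_lt; lra).
assert (P2 : 0 < (1 - r) ^ 3) by (apply pow_lt; lra).
assert (P3 : 0 < 1 - alpha * r) by nra.
assert (P4 : 0 < 1 + alpha * r) by nra.
split.
- destruct Rlt_dec as [L|L]; [|apply Cmod_ge_0].
  apply Rle_div_l; [apply Rmult_lt_0_compat; auto|].
  apply Rle_trans with ((alpha - r) * (H * (1 + r) ^ 3)).
  + apply Rmult_le_compat_l; lra.
  + rewrite <- !Rmult_assoc. apply Rmult_le_compat_r; lra.
- apply Rle_div_r; [apply Rmult_lt_0_compat; auto|].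
  apply Rle_trans with ((alpha + r) * (H * (1 - r) ^ 3)).
  + rewrite <- !Rmult_assoc. apply Rmult_le_compat_r; lra.
  + apply Rmult_le_compat_l; lra.
Qed.
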